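(* Let $(G_t)_{t\in T}$ be a family of bounded domains in $\mathbb{C}^n$ with $\mathcal{C}^2$-smooth boundaries, where $T$ is a compact metric space with associated metric $d$. Suppose we have a domain $U\subset\subset\mathbb{C}^n$ such that $\bigcup_{t\in T}\partial G_t\subset\subset U$ and with the property that for any $\varepsilon>0$ there exists a $\delta>0$ such that for any $s,t\in T$ with $d(s,t)\leq\delta$ we have $\|r_t-r_s\|_{\mathcal{C}^2(U)}<\varepsilon$, where $r_t$ denotes a defining function for $G_t$, defined on $U$ for any $t\in T$. Then there exists a constant $C>0$ such that for any $t\in T$ and any $\zeta\in G_t$ there exists a neighborhood $V=V(\zeta)$ of $\zeta$, of uniform size (that is, containing a ball $\mathbb{B}(\zeta,\rho)$ with $\rho>0$ independent of $t$ and $\zeta$), with the property that $$\boldsymbol{k}_{G_t}(z,w)\leq-\frac{1}{2}\big(\log\mathrm{dist}(z,\partial G_t)+\log\mathrm{dist}(w,\partial G_t)\big)+\frac{1}{2}\big(\log(\mathrm{dist}(z,\partial G_t)+\|z-w\|)+\log(\mathrm{dist}(w,\partial G_t)+\|z-w\|)\big)+C$$ whenever $z,w\in G_t\cap V$. In particular, if $(G_j)_{j\in\mathbb{N}}$ is a sequence of bounded domains with $\mathcal{C}^2$-smooth boundaries such that $G_j$ converges to $G$, a bounded domain with $\mathcal{C}^2$-smooth boundary, with respect to the $\mathcal{C}^2$ topology on domains, then there exists a constant $C>0$ such that for any $j\in\mathbb{N}$ and any $\zeta\in G_j$ there exists a neighborhood $V=V(\zeta)$ of $\zeta$, of uniform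 size (containing a ball $\mathbb{B}(\zeta,\rho)$ with $\rho>0$ independent of $j$ and $\zeta$), with the property that $$\boldsymbol{k}_{G_j}(z,w)\leq-\frac{1}{2}\big(\log\mathrm{dist}(z,\partial G_j)+\log\mathrm{dist}(w,\partial G_j)\big)+\frac{1}{2}\big(\log(\mathrm{dist}(z,\partial G_j)+\|z-w\|)+\log(\mathrm{dist}(w,\partial G_j)+\|z-w\|)\big)+C$$ whenever $z,w\in G_j\cap V$.
   Context: Notation: $\mathbb{B}(\zeta,r)$ is the open Euclidean ball in $\mathbb{C}^n$; $\mathbb{D}$ is the open unit disc in $\mathbb{C}$; $\mathrm{dist}$ is Euclidean distance; $\mathcal{O}(\mathbb{D},G)$ is the set of holomorphic maps $\mathbb{D}\to G$; $A\subset\subset B$ means that $A$ is relatively compact in $B$. $\boldsymbol{p}$ is the Poincaré distance on $\mathbb{D}$, normalized so that $\boldsymbol{p}(0,\lambda)=\frac12\log\frac{1+|\lambda|}{1-|\lambda|}$. The Kobayashi pseudodistance of a domain $G$ is $$\boldsymbol{k}_G(z,w):=\inf\Big\{\sum_{j=1}^N\boldsymbol{p}(\xi_j,\zeta_j)\Big\},\quad z,w\in G,$$ the infimum being over all $N\in\mathbb{N}$, $\xi_j,\zeta_j\in\mathbb{D}$, such that there exist $p_0,\ldots,p_N\in G$ with $p_0=z$, $p_N=w$ and $f_j\in\mathcal{O}(\mathbb{D},G)$ with $f_j(\xi_j)=p_{j-1}$, $f_j(\zeta_j)=p_j$, $j=1,\ldots,N$. A defining function for $G$ on a neighborhood $U$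 of $\partial G$ is a $\mathcal{C}^2$ function $r:U\to\mathbb{R}$ with $G\cap U=\{z\in U:r(z)<0\}$, $(\mathbb{C}^n\setminus\overline{G})\cap U=\{z\in U:r(z)>0\}$, and $\left(\frac{\partial r}{\partial\bar z_1}(z),\ldots,\frac{\partial r}{\partial\bar z_n}(z)\right)\neq 0$ for $z\in\partial G$. Convergence $G_j\to G$ in the $\mathcal{C}^2$ topology on domains means: there are a bounded open set $U\subset\mathbb{C}^n$ and $j_0$ with $\partial G\cup\bigcup_{j\ge j_0}\partial G_j\subset\subset U$, and $\mathcal{C}^2$ defining functions $r$ of $G$ and $r_j$ of $G_j$ ($j\ge j_0$) on $U$ with $\|r_j-r\|_{\mathcal{C}^2(U)}\to0$. *)

(* Defs.v *)
(* C^n is 'rV[R[i]]_n for R : realType.  Its topology is the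
   library's matrix topology (that of the sup norm, hence the usual one); norms
   and distances that enter an estimate are the Euclidean ones defined below. *)
From HB Require Import structures.
From mathcomp Require Import all_boot all_order all_algebra.
From mathcomp Require Import complex.
From mathcomp Require Import all_classical all_reals all_analysis.
Set Implicit Arguments.
Unset Strict Implicit.
Unset Printing Implicit Defensive.
Import Order.TTheory GRing.Theory Num.Theory.
Import numFieldNormedType.Exports.
Import ComplexField.

Local Open Scope classical_set_scope.
Local Open Scope ring_scope.
Local Open Scope complex_scope.

(* R[i] receives the topology of its modulus and becomes a normed module over
   itself. *)
HB.instance Definition _ (R : realType) := NormedModule.copy R[i] R[i]^o.

Section ComplexSpace.
Context {R : realType} {n : nat}.
Implicit Types (z w : 'rV[R[i]]_n) (A G U : set 'rV[R[i]]_n).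

Definition eucl_norm z : R := Num.sqrt (\sum_k Normc.normc (z 0 k) ^+ 2).

Definition eucl_ball z (rho : R) : set 'rV[R[i]]_n := [set w | eucl_norm (w - z) < rho].

Definition eucl_dist z A : R := inf [set eucl_norm (z - w) | w in A].

Definition boundary A : set 'rV[R[i]]_n := closure A `\` interior A.

Definition relatively_compact A U := compact (closure A) /\ closure A `<=` U.

Definition domain G := [/\ open G, connected G & G !=set0].

End ComplexSpace.

Section Smoothness.
Context {R : realType} {n : nat}.
Implicit Types (z : 'rV[R[i]]_n) (G U : set 'rV[R[i]]_n)
  (f r : 'rV[R[i]]_n -> R).

(* Real coordinates of C^n: (k, false) is x_k and (k, true) is y_k, where
   z_k = x_k + i y_k. *)
Definition coord_vec (k : 'I_n * bool) : 'rV[R[i]]_n :=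
  (if k.2 then 'i else 1) *: delta_mx 0 k.1.

Definition along (k : 'I_n * bool) f z : R -> R :=
  fun t => f (z + t%:C *: coord_vec k).

Definition has_partial k f z := derivable (along k f z) 0 1.

Definition partial k f z : R := derive1 (along k f z) 0.

Definition C2_on U f :=
  [/\ {in U, continuous f},
      forall k, {in U, forall z, has_partial k f z},
      forall k, {in U, continuous (partial k f)},
      forall k l, {in U, forall z, has_partial l (partial k f) z} &
      forall k l, {in U, continuous (partial l (partial k f))}].

(* Supremum over U of |D^a f| over all real multi-indices a with |a| <= 2; it is
   extended-real valued because f need not be bounded on U. *)
Definition C2norm U f : \bar R := ereal_sup (
  [set x | exists2 z, U z & x = `|f z|%:E] `|`
  [set x | exists k, exists2 z, U z & x = `|partial k f z|%:E] `|`
  [set x | exists k l, exists2 z, U z & x = `|partial l (partial k f) z|%:E]).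

(* Row of the Wirtinger derivatives
   dr/dzbar_k = (dr/dx_k + i dr/dy_k) / 2. *)
Definition dbar r z : 'rV[R[i]]_n :=
  \row_k ((partial (k, false) r z +i* partial (k, true) r z) / 2).

(* r is a defining function for G on the open neighborhood U of the boundary
   of G; the values of r outside U are irrelevant. *)
Definition defining_function G U r :=
  [/\ open U /\ boundary G `<=` U,
      C2_on U r,
      G `&` U = [set z | U z /\ r z < 0],
      ~` closure G `&` U = [set z | U z /\ 0 < r z] &
      forall z, boundary G z -> dbar r z != 0].

Definition C2_boundary G := exists U r, defining_function G U r.

Definition C2_converges (G_ : nat -> set 'rV[R[i]]_n) G :=
  exists U (j0 : nat) (r_ : nat -> 'rV[R[i]]_n -> R) r,
  [/\ open U /\ bounded_set U,
      relatively_compact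
        (boundary G `|` \bigcup_(j in [set j | (j0 <= j)%N]) boundary (G_ j)) U,
      defining_function G U r,
      forall j, (j0 <= j)%N -> defining_function (G_ j) U (r_ j) &
      C2norm U (fun z => r_ j z - r z) @[j --> \oo] --> 0%:E].

End Smoothness.

Section Kobayashi.
Context {R : realType} {n : nat}.
Implicit Types (z w : 'rV[R[i]]_n) (G : set 'rV[R[i]]_n).

Definition disc : set R[i] := [set a | `|a| < 1].

Definition poincare (a b : R[i]) : R :=
  let m := Normc.normc ((a - b) / (1 - b^* * a)) in
  2^-1 * ln ((1 + m) / (1 - m)).

Definition hol_disc G (f : R[i] -> 'rV[R[i]]_n) :=
  forall a, disc a -> derivable f a 1 /\ G (f a).

(* s is the length of a chain of N >= 1 analytic discs in G joining z to w;
   only the entries p 0, ..., p N and xi j, zeta j, f j with 1 <= j <= N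
   matter. *)
Definition chain_length G z w (s : R) :=
  exists (N : nat) (p : nat -> 'rV[R[i]]_n) (xi zeta : nat -> R[i])
         (f : nat -> R[i] -> 'rV[R[i]]_n),
  [/\ (0 < N)%N,
      p 0%N = z /\ p N = w,
      forall j, (j <= N)%N -> G (p j),
      forall j, (1 <= j <= N)%N ->
        [/\ disc (xi j), disc (zeta j), hol_disc G (f j),
            f j (xi j) = p j.-1 & f j (zeta j) = p j] &
      s = \sum_(1 <= j < N.+1) poincare (xi j) (zeta j)].

(* Extended-real infimum, so that the value would be +oo, not 0, if no chain
   existed; it is finite on a domain. *)
Definition kobayashi G z w : \bar R :=
  ereal_inf [set s%:E | s in chain_length G z w].

End Kobayashi.

(* Main.v *)
Require Import Defs.
From HB Require Import structures.
From mathcomp Require Import all_boot all_order all_algebra.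
From mathcomp Require Import complex.
From mathcomp Require Import all_classical all_reals all_analysis.
From mathcomp Require Import ring lra.
Import Order.TTheory GRing.Theory Num.Theory.
Import numFieldNormedType.Exports.
Local Open Scope classical_set_scope.
Local Open Scope ring_scope.

(** The estimate is local, and everything in it is controlled by one number [e].

    Let [r] be a defining function of [G], and let [p] be a boundary point around
    which, in a ball of radius [e], the derivatives of [r] of order one and two
    are at most [1/e] and [r] decreases at speed at least [e] in a fixed
    direction [v] ([controlled]).  By Taylor's formula, for [z] near [p] and
    complex [a],
      [r (z + a v) <= r z + Re (a b) + M |a|^2], with [Re b <= - e],
    and the right-hand side is negative on a disc of the complex line through
    [z] in direction [v].  This disc lies in [G] ([disc_inside]); [z] is at depth
    comparable to [- r z] in it, hence to the distance [delta z] of [z] to the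
    boundary ([defect_bounds]).  The Poincare metric of the disc shows that
    moving from [z] to [z + s v], where [s] is a large multiple of [|z - w|],
    costs at most
      [1/2 ln ((delta z + |z - w|) / delta z) + const]  ([normal_link]).
    The two logarithmic terms of the claim are the costs of pushing [z] and [w]
    inwards in this way.  Because the same direction [v] serves for both points,
    [z + s v] and [w + s v] are still [|z - w|] apart, while both are now inside
    by a larger amount, so that one affine disc joins them at bounded cost
    ([kobayashi_near_boundary]).  Points far from the boundary are joined by
    a single affine disc ([kobayashi_interior]), which suffices because the sum
    of the logarithms in the claim is nonnegative.

    Uniformity in the parameter is a compactness argument.  Around a zero of one
    defining function some first derivative does not vanish, and by continuity
    a coordinate direction serves as [v] for all functions that are C^2 close to
    it; around a point where it does not vanish, C^2 close domains have no
    boundary points ([controlled_local]).  Covering the compact closure of the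
    union of the boundaries ([controlled_near]), and then the parameter space,
    gives a common [e].  For a convergent sequence the limit filter takes
    the place of the second covering; the finitely many remaining domains are
    treated one at a time. *)

Set Implicit Arguments.
Unset Strict Implicit.
Unset Printing Implicit Defensive.

(** * Real coordinates and norms on C^n *)

Section RealCoordinates.
Context {R : realType} {n : nat}.
Implicit Types (x y z h : 'rV[R[i]]_n) (k : 'I_n * bool).

Definition re_coord k z : R := if k.2 then complex.Im (z 0 k.1) else complex.Re (z 0 k.1).

(** The l^1 norm of the real coordinates.  Paths that change one real coordinate
    at a time have length exactly [norm1], which makes it the natural norm for
    estimates by partial derivatives; it differs from the Euclidean norm by
    factors that depend on [n] only. *)
Definition norm1 z : R := \sum_k `|re_coord k z|.

Lemma ReD (a b : R[i]) : complex.Re (a + b) = complex.Re a + complex.Re b.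
Proof. by case: a b => [? ?] [? ?]. Qed.

Lemma ImD (a b : R[i]) : complex.Im (a + b) = complex.Im a + complex.Im b.
Proof. by case: a b => [? ?] [? ?]. Qed.

Lemma re_coordD k x y : re_coord k (x + y) = re_coord k x + re_coord k y.
Proof. by rewrite /re_coord mxE; case: k.2; rewrite ?ReD ?ImD. Qed.

Lemma re_coordN k x : re_coord k (- x) = - re_coord k x.
Proof. by rewrite /re_coord mxE; case: k.2; case: (x 0 k.1). Qed.

Lemma re_coordB k x y : re_coord k (x - y) = re_coord k x - re_coord k y.
Proof. by rewrite re_coordD re_coordN. Qed.

Lemma re_coordZ k (t : R) x : re_coord k (t%:C%C *: x) = t * re_coord k x.
Proof. rewrite /re_coord mxE; case: k.2; case: (x 0 k.1) => a b /=; ring. Qed.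

Lemma re_coord_vec k l : re_coord l (coord_vec k) = (l == k)%:R :> R.
Proof.
case: k l => [k b] [l c]; rewrite /re_coord /coord_vec !mxE /= xpair_eqE.
by case: b; case: c; case: eqP => //= _; rewrite ?mulr0 ?mulr1 ?andbT ?andbF //=;
  ring.
Qed.

Lemma coord_decomp z : z = \sum_k (re_coord k z)%:C%C *: coord_vec k.
Proof.
rewrite -(pair_big predT predT (fun i b => (re_coord (i, b) z)%:C%C *: coord_vec (i, b))) /=.
apply/rowP => j; rewrite summxE (bigD1 j) //= [X in _ + X]big1 ?addr0 => [|i ij]; last first.
  rewrite summxE big1 // => b _; rewrite /coord_vec !mxE /= eq_sym (negbTE ij).
  by rewrite !mulr0.
rewrite big_bool /= /re_coord /coord_vec !mxE /= eqxx !mulr1.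
case: (z 0 j) => a b /=.
by apply/eqP; rewrite eq_complex /=; apply/andP; split; apply/eqP; ring.
Qed.

Lemma norm1_ge0 z : 0 <= norm1 z.
Proof. exact: sumr_ge0. Qed.

Lemma norm1D x y : norm1 (x + y) <= norm1 x + norm1 y.
Proof.
by rewrite /norm1 -big_split; apply: ler_sum => k _; rewrite re_coordD ler_normD.
Qed.

Lemma norm1N x : norm1 (- x) = norm1 x.
Proof. by apply: eq_bigr => k _; rewrite re_coordN normrN. Qed.

Lemma norm10 : norm1 0 = 0.
Proof. by rewrite /norm1 big1 // => k _; rewrite /re_coord !mxE; case: k.2; rewrite normr0. Qed.

Lemma norm1_triangle y x z : norm1 (x - z) <= norm1 (x - y) + norm1 (y - z).
Proof. by rewrite (le_trans _ (norm1D _ _))// addrA subrK. Qed.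

Lemma norm1_distC x y : norm1 (x - y) = norm1 (y - x).
Proof. by rewrite -norm1N opprB. Qed.

Lemma norm1Z (t : R) x : norm1 (t%:C%C *: x) = `|t| * norm1 x.
Proof. by rewrite /norm1 mulr_sumr; apply: eq_bigr => k _; rewrite re_coordZ normrM. Qed.

Lemma norm1Zi x : norm1 ('i%C *: x) = norm1 x.
Proof.
rewrite /norm1 -!(pair_big predT predT (fun i b => `|re_coord (i, b) _|)) /=.
apply: eq_bigr => j _; rewrite !big_bool /= /re_coord !mxE /=.
case: (x 0 j) => a b /=.
have -> : 0 * b + 1 * a = a :> R by ring.
have -> : 0 * a - 1 * b = - b :> R by ring.
by rewrite normrN addrC.
Qed.

Lemma complex_scaleE (l : R[i]) x :
  l *: x = (complex.Re l)%:C%C *: x + (complex.Im l)%:C%C *: ('i%C *: x).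
Proof. by rewrite {1}(complexE l) scalerDl mulrC scalerA. Qed.

Lemma norm1_scale_le (l : R[i]) x :
  norm1 (l *: x) <= (`|complex.Re l| + `|complex.Im l|) * norm1 x.
Proof.
by rewrite complex_scaleE (le_trans (norm1D _ _)) // !norm1Z norm1Zi mulrDl.
Qed.

Lemma re_coord_le_norm1 k z : `|re_coord k z| <= norm1 z.
Proof. by rewrite /norm1 (bigD1 k) //= lerDl sumr_ge0. Qed.

Lemma normc_sqr (a : R[i]) :
  ComplexField.Normc.normc a ^+ 2 = complex.Re a ^+ 2 + complex.Im a ^+ 2.
Proof. by case: a => a b /=; rewrite sqr_sqrtr // addr_ge0 ?sqr_ge0. Qed.

Lemma eucl_norm_sqr z : eucl_norm z ^+ 2 = \sum_k re_coord k z ^+ 2.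
Proof.
rewrite /eucl_norm sqr_sqrtr ?sumr_ge0 // => [|k _]; last exact: sqr_ge0.
rewrite -(pair_big predT predT (fun i b => re_coord (i, b) z ^+ 2)) /=.
by apply: eq_bigr => k _; rewrite big_bool /= normc_sqr addrC.
Qed.

Lemma eucl_norm_ge0 z : 0 <= eucl_norm z.
Proof. exact: sqrtr_ge0. Qed.

Lemma eucl_norm_le_norm1 z : eucl_norm z <= norm1 z.
Proof.
rewrite -(@ler_pXn2r _ 2) ?nnegrE ?norm1_ge0 ?eucl_norm_ge0 //.
rewrite eucl_norm_sqr expr2 {1}/norm1 mulr_suml; apply: ler_sum => k _.
rewrite -real_normK ?num_real // expr2.
by rewrite ler_wpM2l // re_coord_le_norm1.
Qed.

Lemma re_coord_le_eucl k z : `|re_coord k z| <= eucl_norm z.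
Proof.
rewrite -(@ler_pXn2r _ 2) ?nnegrE ?eucl_norm_ge0 //.
rewrite eucl_norm_sqr real_normK ?num_real //.
by rewrite (bigD1 k) //= lerDl sumr_ge0 // => l _; exact: sqr_ge0.
Qed.

Lemma norm1_le_eucl z : norm1 z <= 2 * n%:R * eucl_norm z.
Proof.
apply: (le_trans (ler_sum _ (fun k _ => re_coord_le_eucl k z))).
by rewrite sumr_const card_prod card_bool card_ord -[leLHS]mulr_natl natrM (mulrC n%:R).
Qed.

End RealCoordinates.

(** * Neighbourhoods, boundaries and the distance to the boundary *)

Section Topology.
Context {R : realType} {n : nat}.
Implicit Types (x y z h p : 'rV[R[i]]_n) (G U : set 'rV[R[i]]_n).
Local Notation normc := ComplexField.Normc.normc.

Lemma normC_E (a : R[i]) : `|a| = (normc a)%:C%C.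
Proof. by []. Qed.

Lemma normc_ge0 (a : R[i]) : 0 <= normc a.
Proof. by case: a => a b; exact: sqrtr_ge0. Qed.

Lemma normc_opp (a : R[i]) : normc (- a) = normc a.
Proof. by case: a => a b /=; rewrite !sqrrN. Qed.

Lemma Re_le_normc (a : R[i]) : `|complex.Re a| <= normc a.
Proof.
rewrite -(@ler_pXn2r _ 2) ?nnegrE ?normc_ge0 // normc_sqr real_normK ?num_real //.
by rewrite lerDl sqr_ge0.
Qed.

Lemma Im_le_normc (a : R[i]) : `|complex.Im a| <= normc a.
Proof.
rewrite -(@ler_pXn2r _ 2) ?nnegrE ?normc_ge0 // normc_sqr real_normK ?num_real //.
by rewrite lerDr sqr_ge0.
Qed.

Lemma re_coord_le_normc (k : 'I_n * bool) z : `|re_coord k z| <= normc (z 0 k.1).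
Proof. by rewrite /re_coord; case: k.2; [exact: Im_le_normc | exact: Re_le_normc]. Qed.

Lemma normc_le_norm1 (k : 'I_n) z : normc (z 0 k) <= norm1 z.
Proof.
apply: (le_trans _ (eucl_norm_le_norm1 z)).
rewrite -(@ler_pXn2r _ 2) ?nnegrE ?eucl_norm_ge0 ?normc_ge0 //.
rewrite /eucl_norm sqr_sqrtr ?sumr_ge0 // => [|i _]; last exact: sqr_ge0.
by rewrite (bigD1 k) //= lerDl sumr_ge0 // => i _; exact: sqr_ge0.
Qed.

Lemma posC_real (e : R[i]) : 0 < e -> e = (complex.Re e)%:C%C /\ 0 < complex.Re e.
Proof. by case: e => a b; rewrite ltcE /= => /andP[/eqP -> ->]. Qed.

(** The balls of [R[i]] have radii in [R[i]], so that this lemma is the passage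
    from the topology of C^n to estimates with real radii. *)
Lemma nbhs_norm1P p (P : set 'rV[R[i]]_n) :
  nbhs p P <-> exists2 eta : R, 0 < eta & forall y, norm1 (y - p) < eta -> P y.
Proof.
split=> [/nbhs_ballP [e /= /posC_real[-> e0] eP]|[eta eta0 etaP]].
  exists (complex.Re e) => // y yp; apply: eP; split; first by rewrite ltcR.
  move=> i j; rewrite -ball_normE /ball_ /= ltcR ord1.
  apply: le_lt_trans yp; rewrite norm1_distC.
  by have := normc_le_norm1 j (p - y); rewrite !mxE.
pose d := eta / (2 * n%:R + 1).
have n0 : 0 < 2 * n%:R + 1 :> R by rewrite ltr_wpDl // mulr_ge0.
have d0 : 0 < d by rewrite divr_gt0.
apply/nbhs_ballP; exists d%:C%C; first by rewrite /= ltcR.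
move=> y [_ yp]; apply: etaP.
have H k : `|re_coord k (y - p)| <= d.
  apply: (le_trans (re_coord_le_normc _ _)); rewrite ltW //.
  have := yp 0 k.1; rewrite -ball_normE /ball_ /= ltcR => yk.
  by rewrite !mxE -opprB normc_opp.
apply: (le_lt_trans (ler_sum _ (fun k _ => H k))).
rewrite sumr_const card_prod card_bool card_ord -[ltLHS]mulr_natl natrM mulrC /d.
by rewrite mulrAC ltr_pdivrMr // ltr_pM2l //; lra.
Qed.

Lemma nbhs_eucl_ball z (rho : R) : 0 < rho -> nbhs z (eucl_ball z rho).
Proof.
move=> r0; apply/nbhs_norm1P; exists rho => // y yz.
exact: le_lt_trans (eucl_norm_le_norm1 _) yz.
Qed.

Lemma open_norm1 G z : open G -> G z ->
  exists2 eta : R, 0 < eta & forall y, norm1 (y - z) < eta -> G y.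
Proof. by rewrite openE => oG /oG /nbhs_norm1P. Qed.

Lemma continuous_norm1 (f : 'rV[R[i]]_n -> R) p (e : R) :
  {for p, continuous f} -> 0 < e ->
  exists2 eta : R, 0 < eta & forall y, norm1 (y - p) < eta -> `|f y - f p| < e.
Proof.
move=> cf e0; have /cf/nbhs_norm1P [eta eta0 H] : nbhs (f p) (ball (f p) e).
  exact: nbhsx_ballx.
exists eta => // y /H.
by rewrite /ball /= distrC.
Qed.

Lemma continuous_segment z h : continuous (fun t : R => z + t%:C%C *: h).
Proof.
move=> t P /nbhs_norm1P [eta eta0 etaP].
have h0 : 0 < norm1 h + 1 by rewrite ltr_wpDl // norm1_ge0.
have : nbhs t (ball t (eta / (norm1 h + 1))) by apply: nbhsx_ballx; rewrite divr_gt0.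
apply: filterS => s; rewrite /ball /= => st; apply: etaP.
have -> : z + s%:C%C *: h - (z + t%:C%C *: h) = (s - t)%:C%C *: h.
  by rewrite opprD addrACA subrr add0r -scalerBl rmorphB.
rewrite norm1Z distrC; move: st; rewrite ltr_pdivlMr // => st.
apply: le_lt_trans st; rewrite ler_wpM2l //; lra.
Qed.

Lemma open_boundary_disjoint G z : open G -> G z -> ~ boundary G z.
Proof. by move=> oG Gz [_]; apply; move: oG; rewrite openE => /(_ _ Gz). Qed.

(** If the segment missed the boundary, the part of it in [G] would be both open
    and closed in the segment. *)
Lemma segment_meets_boundary G z h : open G -> G z -> ~ G (z + h) ->
  exists t : R, [/\ 0 <= t, t <= 1 & boundary G (z + t%:C%C *: h)].
Proof.
move=> oG Gz nG; apply: contrapT => nB; apply: nG.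
pose phi (t : R) := z + t%:C%C *: h.
have cphi : continuous phi by exact: continuous_segment.
have E : `[0, 1]%classic `&` phi @^-1` G = `[0, 1]%classic.
  apply: (@segment_connected _ 0 1).
  - by exists 0; split; rewrite /= ?in_itv /= ?lexx ?ler01 // /phi scale0r addr0.
  - by exists (phi @^-1` G) => //; apply: open_comp => // t _; exact: cphi.
  - exists (phi @^-1` (closure G)).
      by move/continuous_closedP: cphi; apply; exact: closed_closure.
    apply/seteqP; split=> t [t01 Gt]; split=> //; first exact: subset_closure.
    apply: contrapT => nGt; apply: nB; exists t.
    move: t01; rewrite /= in_itv /= => /andP[t0 t1]; split=> //; split=> // iG.
    by apply: nGt; exact: interior_subset iG.
have : `[0, 1]%classic (1 : R) by rewrite /= in_itv /= ler01 lexx.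
by rewrite -E => -[_]; rewrite /phi /= scale1r.
Qed.

Lemma bounded_re_coord G : bounded_set G ->
  exists M : R, forall x, G x -> forall k : 'I_n * bool, `|re_coord k x| <= M.
Proof.
move=> [M [Mreal hM]]; exists (complex.Re M + 1) => x Gx k.
have /complex_realP [m Mm] := Mreal.
have : `|x| <= (m + 1)%:C%C.
  by apply: hM Gx; rewrite Mm ltcR; lra.
rewrite Mm /= => xm; apply: le_trans (re_coord_le_normc k x) _.
rewrite -lecR; apply: le_trans xm.
have : `|x 0 k.1| <= `|x|.
  rewrite [leRHS]/Num.norm /= mx_normE -[leLHS]nngE num_le.
  exact: (@le_bigmax _ _ _ _ (fun i => `|x i.1 i.2|%:nng) (0, k.1)).
by rewrite normC_E.
Qed.

Lemma compact_re_box (M : R) :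
  compact [set x : 'rV[R[i]]_n | forall k, `|re_coord k x| <= M].
Proof.
have cA : compact [set a : R[i] | `|complex.Re a| <= M /\ `|complex.Im a| <= M].
  pose f (u : R * R) : R[i] := Complex u.1 u.2.
  have -> : [set a : R[i] | `|complex.Re a| <= M /\ `|complex.Im a| <= M] =
      f @` (`[- M, M]%classic `*` `[- M, M]%classic).
    apply/seteqP; split=> [[a b] /= [aM bM]|_ [[a b] /= [aM bM] <-]].
      by exists (a, b) => //=; rewrite !in_itv /= -!ler_norml.
    by move: aM bM; rewrite !in_itv /= -!ler_norml.
  apply: continuous_compact; last by apply: compact_setX; exact: segment_compact.
  apply: continuous_subspaceT => -[a b] P /nbhs_ballP [e /= /posC_real[-> e0] eP].
  have : nbhs (a, b) (ball (a, b) (complex.Re e / 2)).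
    by apply: nbhsx_ballx; rewrite divr_gt0.
  apply: filterS => -[c d] [/=]; rewrite /ball /= => ca db; apply: eP.
  rewrite -ball_normE /ball_ /= ltcR.
  set u := Complex a b - Complex c d.
  have H1 : `|complex.Re u| < complex.Re e / 2 by [].
  have H2 : `|complex.Im u| < complex.Re e / 2 by [].
  rewrite -(@ltr_pXn2r _ 2) ?nnegrE ?normc_ge0 ?(ltW e0) // normc_sqr.
  move: H1 H2; move: (complex.Re u) (complex.Im u) (complex.Re e) e0 => p q r r0.
  rewrite !ltr_norml => /andP[p1 p2] /andP[q1 q2]; nra.
have := @rV_compact _ n (fun=> _) (fun=> cA).
congr (compact _); apply/seteqP; split=> x /= H.
  by move=> [k b]; rewrite /re_coord /=; have [? ?] := H k; case: b.
by move=> k; have := H (k, true); have := H (k, false).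
Qed.

(** Reduces to a product of squares in [R[i]], which are images of squares of
    real numbers. *)
Lemma compact_closed_bounded G : bounded_set G -> compact (closure G).
Proof.
move=> /bounded_re_coord [M hM].
apply (subclosed_compact (@closed_closure _ G) (@compact_re_box M)).
move=> x Gx k; apply/ler_addgt0Pr => e e0.
have /Gx [y [Gy xy]] : nbhs x [set y | norm1 (y - x) < e].
  by apply/nbhs_norm1P; exists e.
have := hM _ Gy k; have := re_coord_le_norm1 k (y - x).
rewrite re_coordB => H1 H2.
have -> : re_coord k x = re_coord k y - (re_coord k y - re_coord k x) by ring.
apply: le_trans (ler_normB _ _) _; apply: lerD => //.
by apply: le_trans H1 _; exact: ltW.
Qed.

Lemma boundary_closed G : open G -> closed (boundary G).
Proof.
move=> oG; rewrite /boundary; apply: closedI; first exact: closed_closure.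
by apply: open_closedC; exact: open_interior.
Qed.

(** A bounded [G] omits some point, and a segment from [G] to it crosses the
    boundary.  This matters because the distance to the empty set is [0] by
    convention, which would make the logarithms of the main bound meaningless. *)
Lemma boundary_neq0 G : (0 < n)%N -> open G -> G !=set0 -> bounded_set G ->
  boundary G !=set0.
Proof.
move=> n0 oG [z Gz] /bounded_re_coord [M hM].
pose k := Ordinal n0.
pose y : 'rV[R[i]]_n := (M + 1)%:C%C *: coord_vec (k, false).
have nGy : ~ G (z + (y - z)).
  rewrite addrC subrK => /hM /(_ (k, false)).
  rewrite re_coordZ re_coord_vec eqxx mulr1 => H.
  by have := le_trans (ler_norm _) H; rewrite gerDl ler10.
by have [t [_ _ bt]] := segment_meets_boundary oG Gz nGy; eexists; exact: bt.
Qed.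

Lemma eucl_dist_le z y G : G y -> eucl_dist z G <= eucl_norm (z - y).
Proof.
move=> Gy; apply: ge_inf; last by exists y.
by exists 0 => _ [w _ <-]; exact: eucl_norm_ge0.
Qed.

Lemma eucl_dist_gt0 z G : (0 < n)%N -> open G -> bounded_set G -> G z ->
  0 < eucl_dist z (boundary G).
Proof.
move=> n0 oG bG Gz; have [eta eta0 etaG] := open_norm1 oG Gz.
have n0' : 0 < n%:R :> R by rewrite ltr0n.
have d0 : 0 < eta / (2 * n%:R) by rewrite divr_gt0 // mulr_gt0.
apply: (lt_le_trans d0); apply: lb_le_inf.
  by have [|p bp] := boundary_neq0 n0 oG _ bG; [exists z|exists (eucl_norm (z - p)), p].
move=> _ [p bp <-]; rewrite leNgt; apply/negP => H.
apply: (open_boundary_disjoint oG _ bp); apply: etaG.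
rewrite norm1_distC; apply: (le_lt_trans (norm1_le_eucl _)).
by move: H; rewrite ltr_pdivlMr ?mulr_gt0 // mulrC.
Qed.

End Topology.

(** * The mean value inequality along coordinate paths *)

Section MeanValue.
Context {R : realType} {n : nat}.
Implicit Types (x y z h : 'rV[R[i]]_n) (k : 'I_n * bool) (f : 'rV[R[i]]_n -> R).

Lemma norm1_coord_vec k : norm1 (coord_vec k : 'rV[R[i]]_n) = 1.
Proof.
rewrite /norm1 (bigD1 k) //= re_coord_vec eqxx normr1 big1 ?addr0 // => l lk.
by rewrite re_coord_vec (negbTE lk) normr0.
Qed.

Lemma is_derive_along k f z (t : R) :
  has_partial k f (z + t%:C%C *: coord_vec k) ->
  is_derive t 1 (along k f z) (partial k f (z + t%:C%C *: coord_vec k)).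
Proof.
move=> dk; set y := z + _ in dk *.
have -> : along k f z = along k f y \o (fun s => s - t).
  apply/funext => s; rewrite /along /y /= -addrA -scalerDl -rmorphD /=.
  by rewrite [t + _]addrC subrK.
have E : (fun s : R => s - t) t = 0 by exact: subrr.
have d1 : is_derive ((fun s : R => s - t) t) 1 (along k f y) (partial k f y).
  rewrite E /partial derive1E; exact: DeriveDef.
have d2 : is_derive t 1 (fun s : R => s - t) 1.
  have := @is_deriveB _ _ _ id (cst t) t 1 1 0 (is_derive_id _ _) (is_derive_cst _ _ _).
  by rewrite subr0.
by have := @is_derive1_comp R (along k f y) (fun s => s - t) t _ _ d1 d2; rewrite mulr1.
Qed.

Lemma mean_value_coord k f z (t c B : R) :
  (forall s : R, `|s| <= `|t| -> has_partial k f (z + s%:C%C *: coord_vec k) /\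
     `|partial k f (z + s%:C%C *: coord_vec k) - c| <= B) ->
  `|f (z + t%:C%C *: coord_vec k) - f z - c * t| <= B * `|t|.
Proof.
move=> H.
have der (s : R) : `|s| <= `|t| ->
    is_derive s 1 (along k f z) (partial k f (z + s%:C%C *: coord_vec k)).
  by move=> /H[dk _]; exact: is_derive_along.
have E0 : along k f z 0 = f z by rewrite /along scale0r addr0.
have Et : along k f z t = f (z + t%:C%C *: coord_vec k) by [].
have key : exists2 s : R, `|s| <= `|t| &
    along k f z t - along k f z 0 = partial k f (z + s%:C%C *: coord_vec k) * t.
  have [t0|t0] := leP 0 t.
    have [||s] := @MVT_segment R (along k f z)
        (fun s => partial k f (z + s%:C%C *: coord_vec k)) 0 t t0.
    - move=> s; rewrite in_itv /= => /andP[s0 st]; apply: der.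
      by rewrite (ger0_norm t0) gtr0_norm // ltW.
    - apply: derivable_within_continuous => s; rewrite in_itv /= => /andP[s0 st].
      by have /der[] : `|s| <= `|t| by rewrite !ger0_norm.
    rewrite in_itv /= => /andP[s0 st]; rewrite subr0 => ->.
    by exists s => //; rewrite !ger0_norm.
  have [||s] := @MVT_segment R (along k f z)
      (fun s => partial k f (z + s%:C%C *: coord_vec k)) t 0 (ltW t0).
  - move=> s; rewrite in_itv /= => /andP[s0 st]; apply: der.
    by rewrite !ltr0_norm // lerN2 ltW.
  - apply: derivable_within_continuous => s; rewrite in_itv /= => /andP[s0 st].
    by have /der[] : `|s| <= `|t| by rewrite (ltr0_norm t0) ler0_norm // lerN2.
  rewrite in_itv /= => /andP[s0 st] Es.
  exists s; first by rewrite (ltr0_norm t0) ler0_norm // lerN2.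
  by rewrite -opprB Es; ring.
have [s st Es] := key.
rewrite -Et -E0 Es -mulrBl normrM ler_wpM2r //; exact: (H s st).2.
Qed.

(** Increments along the coordinates are added up: each step is the
    one-dimensional mean value theorem, and all intermediate points stay within
    [norm1 h] of [z] because the steps have total length [norm1 h].  With
    [c = 0] this is a Lipschitz bound; with [c] the gradient at [z] it is the
    remainder in Taylor's formula of order one. *)
Lemma mean_value f z h (c : 'I_n * bool -> R) (B : R) :
  (forall k y, norm1 (y - z) <= norm1 h ->
     has_partial k f y /\ `|partial k f y - c k| <= B) ->
  `|f (z + h) - f z - \sum_k c k * re_coord k h| <= B * norm1 h.
Proof.
move=> H.
have aux s : \sum_(k <- s) `|re_coord k h| <= norm1 h ->
  norm1 (\sum_(k <- s) (re_coord k h)%:C%C *: coord_vec k)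
    <= \sum_(k <- s) `|re_coord k h| /\
  `|f (z + \sum_(k <- s) (re_coord k h)%:C%C *: coord_vec k) - f z
    - \sum_(k <- s) c k * re_coord k h| <= B * \sum_(k <- s) `|re_coord k h|.
  elim: s => [|k s IH]; first by rewrite !big_nil addr0 subrr subr0 normr0 mulr0 norm10.
  rewrite !big_cons; set hs := \sum_(j <- s) _ *: _; set ns := \sum_(j <- s) `|_|.
  set cs := \sum_(j <- s) _ * _ => le_h.
  have [nhs fhs] : norm1 hs <= ns /\ `|f (z + hs) - f z - cs| <= B * ns.
    by apply: IH; apply: le_trans le_h; rewrite lerDr.
  split.
    by rewrite (le_trans (norm1D _ _)) // norm1Z norm1_coord_vec mulr1 lerD2l.
  have step : `|f (z + hs + (re_coord k h)%:C%C *: coord_vec k) - f (z + hs)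
      - c k * re_coord k h| <= B * `|re_coord k h|.
    apply: mean_value_coord => t tk; apply: H.
    have -> : z + hs + t%:C%C *: coord_vec k - z = t%:C%C *: coord_vec k + hs.
      by rewrite -(addrA z) [z + _]addrC addrK addrC.
    apply: le_trans le_h; rewrite (le_trans (norm1D _ _)) //.
    by rewrite norm1Z norm1_coord_vec mulr1 lerD.
  rewrite mulrDr [_ *: _ + hs]addrC addrA.
  apply: le_trans (lerD step fhs).
  by apply: le_trans (ler_normD _ _); rewrite le_eqVlt; apply/orP; left;
    apply/eqP; congr `|_|; ring.
by have [_] := aux _ (lexx _); rewrite -coord_decomp.
Qed.

End MeanValue.

(** * Affine analytic discs and their Poincare length *)

Section Discs.
Context {R : realType} {n : nat}.
Implicit Types (x y z w v h p : 'rV[R[i]]_n) (G U : set 'rV[R[i]]_n) (a b : R[i]).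
Local Notation normc := ComplexField.Normc.normc.

Lemma discE a : disc a <-> complex.Re a ^+ 2 + complex.Im a ^+ 2 < 1.
Proof.
rewrite /disc /= normC_E (ltcR _ 1) -normc_sqr.
by rewrite -(@ltr_pXn2r _ 2) ?nnegrE ?normc_ge0 // expr1n.
Qed.

(** With [m] the pseudohyperbolic distance,
    [(1 + m) / (1 - m) = (1 + m)^2 / (1 - m^2) <= 4 / (1 - m^2)], and
    [1 - m^2 = (1 - |a|^2) (1 - |b|^2) / |1 - conj b a|^2].  The loss of a
    factor [4] only contributes to the additive constant. *)
Lemma poincare_le a b (B : R) : disc a -> disc b ->
  4 * normc (1 - conjc b * a) ^+ 2
    <= B * ((1 - normc a ^+ 2) * (1 - normc b ^+ 2)) ->
  poincare a b <= 2^-1 * ln B.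
Proof.
move=> /discE da /discE db; rewrite -normc_sqr in da; rewrite -normc_sqr in db.
set D := _ * (1 - _) => HB.
have D0 : 0 < D by rewrite mulr_gt0 // subr_gt0.
rewrite /poincare; set m := normc _.
have idPQ : normc (1 - conjc b * a) ^+ 2 = normc (a - b) ^+ 2 + D.
  rewrite /D !normc_sqr; case: (a) (b) => [a1 a2] [b1 b2] /=; ring.
have m_def : m = normc (a - b) / normc (1 - conjc b * a).
  by rewrite /m ComplexField.Normc.normcM ComplexField.Normc.normcV.
have P0 := normc_ge0 (a - b); have Q0 := normc_ge0 (1 - conjc b * a).
move: (normc (a - b)) (normc (1 - conjc b * a)) P0 Q0 idPQ m_def HB.
move=> P Q P0 Q0 idPQ m_def HB.
have PQ : P < Q.
  by rewrite -(@ltr_pXn2r _ 2) ?nnegrE // idPQ; lra.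
have Qgt0 : 0 < Q by exact: le_lt_trans PQ.
have -> : (1 + m) / (1 - m) = (Q + P) / (Q - P).
  by rewrite m_def; field; rewrite !gt_eqF ?subr_gt0.
rewrite ler_pM2l ?invr_gt0 // ler_ln ?posrE ?divr_gt0 ?subr_gt0 //; last 2 first.
- by lra.
- have : 0 < B * D by apply: lt_le_trans HB; rewrite mulr_gt0 // exprn_gt0.
  by rewrite pmulr_lgt0.
rewrite ler_pdivrMr ?subr_gt0 // -(ler_pM2r (_ : 0 < Q + P)); last by lra.
have -> : B * (Q - P) * (Q + P) = B * D by move: idPQ => /eqP; rewrite -subr_eq0 => /eqP H; nra.
apply: le_trans HB; nra.
Qed.

Lemma hol_disc_affine G u v :
  (forall a, disc a -> G (u + a *: v)) -> hol_disc G (fun a => u + a *: v).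
Proof.
move=> H a da; split; last exact: H.
have aff : differentiable ((fun b : R[i] => u + b *: v) : R[i] -> 'rV[R[i]]_n) a.
  apply: differentiableD; first exact: differentiable_cst.
  by apply: differentiableZl; by [].
exact: diff_derivable.
Qed.

(** One link of a Kobayashi chain, with an upper bound for its length rather
    than the length itself, so that estimates can be chained. *)
Definition disc_link G z w (l : R) := exists (a b : R[i]) f,
  [/\ disc a, disc b, hol_disc G f & f a = z /\ f b = w] /\ poincare a b <= l.

Lemma kobayashi_link G z w l : disc_link G z w l -> (kobayashi G z w <= l%:E)%E.
Proof.
move=> [a [b [f [[da db hf [fa fb]] le_l]]]].
apply: (@le_trans _ _ (poincare a b)%:E); last by rewrite lee_fin.
apply: ereal_inf_lbound; exists (poincare a b) => //.
exists 1%N, (nth 0 [:: z; w]), (fun=> a), (fun=> b), (fun=> f); split=> //.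
- by case=> [|[|//]] _ /=; rewrite -?fa -?fb; apply: (hf _ _).2.
- by case=> [|[|//]].
- by rewrite big_nat1.
Qed.

Lemma kobayashi_link3 G z x y w l1 l2 l3 :
  disc_link G z x l1 -> disc_link G x y l2 -> disc_link G y w l3 ->
  (kobayashi G z w <= (l1 + l2 + l3)%:E)%E.
Proof.
move=> [a1 [b1 [f1 [[da1 db1 hf1 [fa1 fb1]] le1]]]].
move=> [a2 [b2 [f2 [[da2 db2 hf2 [fa2 fb2]] le2]]]].
move=> [a3 [b3 [f3 [[da3 db3 hf3 [fa3 fb3]] le3]]]].
apply: (@le_trans _ _ (poincare a1 b1 + poincare a2 b2 + poincare a3 b3)%:E); last first.
  by rewrite lee_fin !lerD.
apply: ereal_inf_lbound; exists (poincare a1 b1 + poincare a2 b2 + poincare a3 b3) => //.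
exists 3%N, (nth 0 [:: z; x; y; w]), (nth 0 [:: 0; a1; a2; a3]),
  (nth 0 [:: 0; b1; b2; b3]), (nth f1 [:: f1; f1; f2; f3]); split=> //.
- case=> [|[|[|[|//]]]] _ /=.
  + by rewrite -fa1; apply: (hf1 _ _).2.
  + by rewrite -fb1; apply: (hf1 _ _).2.
  + by rewrite -fb2; apply: (hf2 _ _).2.
  + by rewrite -fb3; apply: (hf3 _ _).2.
- by case=> [|[|[|[|//]]]].
- by rewrite 3?big_ltn // big_geq //= addr0 addrA.
Qed.

(** The points are the images of [0] and [1/2] under an affine disc; [16 / 3] is
    what [poincare_le] gives for this pair. *)
Lemma disc_link_near G z h :
  (forall a : R[i], normc a < 2 -> G (z + a *: h)) ->
  disc_link G z (z + h) (2^-1 * ln (16 / 3)).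
Proof.
move=> H; exists 0, (2^-1), (fun a => z + a *: (2 *: h)).
have d0 : disc (0 : R[i]) by rewrite /disc /= normr0 ltr01.
have d1 : disc (2^-1 : R[i]).
  by rewrite /disc /= ger0_norm ?invr_ge0 // invf_lt1 // ltr1n.
split; first split=> //.
- apply: hol_disc_affine => a; rewrite /disc /= normC_E (ltcR _ 1) => da.
  rewrite scalerA; apply: H; rewrite ComplexField.Normc.normcM.
  have -> : normc (2 : R[i]) = 2.
    apply: complexI; rewrite -normC_E normr_nat rmorph_nat //.
  by lra.
- by rewrite scale0r addr0 scalerA mulVf ?scale1r.
apply: poincare_le => //.
rewrite mulr0 subr0 ComplexField.Normc.normc0 ComplexField.Normc.normc1.
have -> : normc (2^-1 : R[i]) = 2^-1.
  by apply: complexI; rewrite -normC_E normfV normr_nat rmorphV ?unitfE ?pnatr_eq0 // rmorph_nat.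
by lra.
Qed.

(** The hypothesis on [G] says that it contains the image of the disc with
    centre [c = c1 + i c2] whose squared radius exceeds [|c|^2] by [A], so that
    the origin is at depth about [A / |c|] in it.  In the formula for the
    Poincare distance of [0] and [s] in this disc the radius cancels: the
    relevant quantities are [A] for [0], [A + s (2 c1 - s)] for [s], and
    [|A + c s|^2] for the mixed term. *)
Lemma disc_link_off_center G z v (c1 c2 A s B : R) :
  0 < A -> 0 <= s -> s <= c1 ->
  (forall a : R[i], (complex.Re a - c1) ^+ 2 + (complex.Im a - c2) ^+ 2
      < A + c1 ^+ 2 + c2 ^+ 2 -> G (z + a *: v)) ->
  4 * ((A + c1 * s) ^+ 2 + (c2 * s) ^+ 2) <= B * (A * (A + c1 * s)) ->
  disc_link G z (z + s%:C%C *: v) (2^-1 * ln B) /\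
  disc_link G (z + s%:C%C *: v) z (2^-1 * ln B).
Proof.
move=> A0 s0 sc1 HG HB.
have B0 : 0 <= B.
  have p : 0 < A + c1 * s by nra.
  have : 0 <= B * (A * (A + c1 * s)) by apply: le_trans HB; nra.
  by rewrite pmulr_lge0 // mulr_gt0.
set r := Num.sqrt (A + c1 ^+ 2 + c2 ^+ 2).
have r2 : r ^+ 2 = A + c1 ^+ 2 + c2 ^+ 2 by rewrite sqr_sqrtr //; nra.
have r0 : 0 < r by rewrite sqrtr_gt0; nra.
have rn0 : r != 0 by rewrite gt_eqF.
(* The disc is [c + r D]; [a] and [b] are the parameters of [0] and [s]. *)
pose c := Complex c1 c2.
pose a := Complex (- c1 / r) (- c2 / r).
pose b := Complex ((s - c1) / r) (- c2 / r).
pose f (l : R[i]) := (z + c *: v) + l *: (r%:C%C *: v).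
have da : disc a.
  apply/discE; rewrite /a /= !expr_div_n !sqrrN -mulrDl ltr_pdivrMr ?exprn_gt0 //.
  rewrite r2; lra.
have db : disc b.
  apply/discE; rewrite /b /= !expr_div_n !sqrrN -mulrDl ltr_pdivrMr ?exprn_gt0 //.
  rewrite r2; nra.
have hf : hol_disc G f.
  apply: hol_disc_affine => l /discE dl; rewrite scalerA -addrA -scalerDl.
  apply: HG; move: dl; case: l => l1 l2 /= dl.
  have -> : c1 + (l1 * r - l2 * 0) - c1 = l1 * r by ring.
  have -> : c2 + (l1 * 0 + l2 * r) - c2 = l2 * r by ring.
  by rewrite !exprMn -mulrDl -r2 gtr_pMl // exprn_gt0.
have fa : f a = z.
  rewrite /f scalerA -addrA -scalerDl.
  have -> : c + a * r%:C%C = 0.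
    apply/eqP; rewrite eq_complex /=; apply/andP; split; apply/eqP; by field.
  by rewrite scale0r addr0.
have fb : f b = z + s%:C%C *: v.
  rewrite /f scalerA -addrA -scalerDl.
  have -> // : c + b * r%:C%C = s%:C%C.
  apply/eqP; rewrite eq_complex /=; apply/andP; split; apply/eqP; by field.
have E1 : normc a ^+ 2 = (c1 ^+ 2 + c2 ^+ 2) / r ^+ 2.
  by rewrite normc_sqr /=; field.
have E2 : normc b ^+ 2 = ((s - c1) ^+ 2 + c2 ^+ 2) / r ^+ 2.
  by rewrite normc_sqr /=; field.
have bd : 4 * (((A + c1 * s) ^+ 2 + (c2 * s) ^+ 2) / r ^+ 2 ^+ 2) <=
    B * ((1 - normc a ^+ 2) * (1 - normc b ^+ 2)).
  have -> : B * ((1 - normc a ^+ 2) * (1 - normc b ^+ 2)) =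
      (B * (A * (A + s * (2 * c1 - s)))) / r ^+ 2 ^+ 2.
    rewrite E1 E2; apply/eqP; rewrite eq_sym -subr_eq0; apply/eqP.
    rewrite (_ : A + s * (2 * c1 - s) = r ^+ 2 - ((s - c1) ^+ 2 + c2 ^+ 2)); last by rewrite r2; ring.
    rewrite (_ : A = r ^+ 2 - (c1 ^+ 2 + c2 ^+ 2)); last by rewrite r2; ring.
    by field.
  rewrite mulrA ler_pM2r ?invr_gt0 ?exprn_gt0 //.
  apply: (le_trans HB); apply: ler_wpM2l => //; apply: ler_wpM2l; first exact: ltW.
  nra.
have n1 : normc (1 - conjc b * a) ^+ 2 = ((A + c1 * s) ^+ 2 + (c2 * s) ^+ 2) / r ^+ 2 ^+ 2.
  rewrite normc_sqr /=.
  rewrite (_ : A = r ^+ 2 - (c1 ^+ 2 + c2 ^+ 2)); last by rewrite r2; ring.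
  by field.
have n2 : normc (1 - conjc a * b) ^+ 2 = ((A + c1 * s) ^+ 2 + (c2 * s) ^+ 2) / r ^+ 2 ^+ 2.
  rewrite -n1 !normc_sqr /=; ring.
split; [exists a, b, f; split; first by split|exists b, a, f; split; first by split].
  by apply: poincare_le => //; rewrite n1.
apply: poincare_le => //; rewrite n2 [(1 - _) * _]mulrC; exact: bd.
Qed.

End Discs.

(** * A defining function near a boundary point *)

Section LocalEstimate.
Context {R : realType} {n : nat}.
Implicit Types (x y z w v h p : 'rV[R[i]]_n) (G U : set 'rV[R[i]]_n)
  (r : 'rV[R[i]]_n -> R).

(** The real differential of [r] at [z], applied to [h]. *)
Definition dir_deriv r z h : R := \sum_k partial k r z * re_coord k h.

(** Quantitative form of the statement that [r] is a C^2 defining function near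
    [p], with inward direction [v]: the single number [e] bounds the size of the
    neighbourhood, the derivatives of [r] and the inward slope. *)
Definition controlled U r p v (e : R) :=
  [/\ 0 < e <= 1, norm1 v <= 1,
      forall y, norm1 (y - p) < e ->
        [/\ U y,
            forall k, has_partial k r y /\ `|partial k r y| <= e^-1 &
            forall k l, has_partial l (partial k r) y /\
              `|partial l (partial k r) y| <= e^-1] &
      forall y, norm1 (y - p) < e -> dir_deriv r y v <= - e].

Lemma controlled_lipschitz U r p v (e : R) z h : controlled U r p v e ->
  norm1 (z - p) + norm1 h < e -> `|r (z + h) - r z| <= e^-1 * norm1 h.
Proof.
move=> [_ _ Hp _] zh.
have := @mean_value _ _ r z h (fun=> 0) e^-1.
under [X in `|_ - X|]eq_bigr do rewrite mul0r.
rewrite big1 ?subr0 // => -> // k y yz.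
have /Hp[_ /(_ k) [? ?] _] : norm1 (y - p) < e.
  by apply: le_lt_trans (norm1_triangle z _ _) _; lra.
by rewrite subr0.
Qed.

Lemma controlled_taylor U r p v (e : R) z h : controlled U r p v e ->
  norm1 (z - p) + norm1 h < e ->
  `|r (z + h) - r z - dir_deriv r z h| <= e^-1 * norm1 h ^+ 2.
Proof.
move=> [/andP[e0 _] _ Hp _] zh.
rewrite expr2 mulrA; apply: mean_value => k y yz.
have /Hp[_ /(_ k) [? _] _] : norm1 (y - p) < e.
  by apply: le_lt_trans (norm1_triangle z _ _) _; lra.
split=> //.
have := @mean_value _ _ (partial k r) z (y - z) (fun=> 0) e^-1.
under [X in `|_ - X|]eq_bigr do rewrite mul0r.
rewrite big1 ?subr0 // [z + _]addrC subrK => H.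
apply: (le_trans (H _)); last by rewrite ler_wpM2l // invr_ge0 ltW.
move=> l x xz; rewrite subr0.
have /Hp[_ _ /(_ k l) //] : norm1 (x - p) < e.
by apply: le_lt_trans (norm1_triangle z _ _) _; lra.
Qed.

Lemma dir_derivZ r z (t : R) h : dir_deriv r z (t%:C%C *: h) = t * dir_deriv r z h.
Proof.
by rewrite /dir_deriv mulr_sumr; apply: eq_bigr => k _; rewrite re_coordZ mulrCA.
Qed.

Lemma dir_derivD r z h h' : dir_deriv r z (h + h') = dir_deriv r z h + dir_deriv r z h'.
Proof.
by rewrite /dir_deriv -big_split; apply: eq_bigr => k _; rewrite re_coordD mulrDr.
Qed.

Lemma dir_deriv_le U r p v (e : R) z h : controlled U r p v e -> norm1 (z - p) < e ->
  `|dir_deriv r z h| <= e^-1 * norm1 h.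
Proof.
move=> [_ _ Hp _] /Hp[_ H _]; apply: (le_trans (ler_norm_sum _ _ _)).
rewrite /norm1 mulr_sumr; apply: ler_sum => k _; rewrite normrM ler_wpM2r //.
exact: (H k).2.
Qed.

Lemma defining_lt0 G U r z : defining_function G U r -> U z -> r z < 0 -> G z.
Proof.
move=> [_ _ E _ _] Uz rz; have : [set z | U z /\ r z < 0] z by [].
by rewrite -E => -[].
Qed.

Lemma defining_in G U r z : defining_function G U r -> U z -> G z -> r z < 0.
Proof. by move=> [_ _ E _ _] Uz Gz; have : (G `&` U) z by []; rewrite E => -[]. Qed.

Lemma defining_boundary G U r p : open G -> defining_function G U r ->
  boundary G p -> U p /\ r p = 0.
Proof.
move=> oG def bp; have [[_ /(_ _ bp) Up] _ E1 E2 _] := def; split=> //.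
apply/eqP; rewrite eq_le; apply/andP; split; rewrite leNgt; apply/negP => rp.
  have : [set z | U z /\ 0 < r z] p by [].
  by rewrite -E2 => -[nG _]; have [cG _] := bp.
exact: (open_boundary_disjoint oG (defining_lt0 def Up rp)).
Qed.

Lemma near_lt_e (e t : R) : 0 < e <= 1 -> t <= e ^+ 4 / 4 -> t <= e / 4.
Proof.
move=> /andP[e0 e1] H; apply: le_trans H _; rewrite ler_pM2r ?invr_gt0 // exprS.
by rewrite ger_pMr // exprn_ile1 // ltW.
Qed.

(** Going outwards from [z] in direction [- v] by [s = 2 (- r z) / e], the linear
    part of [r] grows by at least [2 (- r z)] and the quadratic error is at most
    [- r z]; so the path has left [G], and the distance to the boundary is at
    most [s]. *)
Lemma defect_bounds G U r p v (e : R) z :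
  open G -> defining_function G U r -> boundary G p ->
  controlled U r p v e ->
  G z -> norm1 (z - p) <= e ^+ 4 / 4 ->
  [/\ 0 < - r z, - r z <= e ^+ 3 / 4 & e * eucl_dist z (boundary G) <= 2 * - r z].
Proof.
move=> oG def bp ctrl; have [/andP[e0 e1] v1 cP vP] := ctrl.
set i := e^-1.
have ie : i * e = 1 by rewrite mulVf // gt_eqF.
have i1 : 1 <= i by rewrite invf_ge1.
move=> Gz zp; have zp4 := near_lt_e (introT andP (conj e0 e1)) zp.
have zpe : norm1 (z - p) < e by lra.
have [Uz _ _] := cP _ zpe.
have rz : r z < 0 by exact: (defining_in def Uz Gz).
have [_ rp] := defining_boundary oG def bp.
have m1 : - r z <= e ^+ 3 / 4.
  have ie4 : i * e ^+ 4 = e ^+ 3 by rewrite exprS mulrA ie mul1r.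
  have := @controlled_lipschitz U r p v e p (z - p) ctrl.
  rewrite subrr norm10 add0r => /(_ zpe); rewrite [p + _]addrC subrK rp subr0 => H.
  have := ler_norm (- r z); rewrite normrN => /le_trans -> //.
  apply: (le_trans H); rewrite -ie4 -mulrA ler_wpM2l // invr_ge0 ltW //.
split=> //; first lra.
move: m1; set mu := - r z => m1; have mu0 : 0 < mu by rewrite /mu; lra.
(* The distance after which [r] is certainly nonnegative. *)
pose s := 2 * mu * i.
have s0 : 0 <= s by rewrite /s; nra.
have ie3 : i * e ^+ 3 = e ^+ 2 by rewrite exprS mulrA ie mul1r.
have se2 : s <= e ^+ 2 / 2 by rewrite /s -ie3; nra.
have ee : e ^+ 2 <= e by nra.
pose h := (- s)%:C%C *: v.
have hs : norm1 h <= s.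
  by rewrite norm1Z normrN ger0_norm // ler_piMr.
have zh : norm1 (z - p) + norm1 h < e by lra.
have Uy : U (z + h).
  have [] // := cP (z + h).
  apply: le_lt_trans (norm1_triangle z _ _) _.
  by rewrite [z + h]addrC addrK; lra.
have ry : 0 <= r (z + h).
  have := controlled_taylor ctrl zh.
  have dv : s * e <= dir_deriv r z h by rewrite dir_derivZ; have := vP _ zpe; nra.
  have se : s * e = 2 * mu by rewrite /s -mulrA ie mulr1.
  have h2 : e^-1 * norm1 h ^+ 2 <= mu.
    have : norm1 h ^+ 2 <= s ^+ 2 by rewrite ler_pXn2r ?nnegrE ?norm1_ge0.
    rewrite -(ler_pM2l (_ : 0 < e^-1)) ?invr_gt0 // => /le_trans -> //.
    rewrite -/i.
    have -> : i * s ^+ 2 = 2 * mu * (i * i * s) by rewrite /s; ring.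
    have : i * i * s <= i * i * (e ^+ 2 / 2) by rewrite ler_wpM2l //; nra.
    have -> : i * i * (e ^+ 2 / 2) = (i * e) ^+ 2 / 2 by ring.
    by rewrite ie; nra.
  by rewrite ler_norml => /andP[H _]; rewrite /mu in dv se h2 *; lra.
have nG : ~ G (z + h) by move=> /(defining_in def Uy); lra.
have [t [t0 t1 bt]] := segment_meets_boundary oG Gz nG.
apply: (@le_trans _ _ (e * s)); last by rewrite /s; nra.
apply: ler_wpM2l; first exact: ltW.
apply: (le_trans (eucl_dist_le z bt)).
apply: (le_trans (eucl_norm_le_norm1 _)).
rewrite opprD addrA subrr sub0r norm1N norm1Z ger0_norm //.
apply: le_trans hs; rewrite ler_piMl ?norm1_ge0 //.
Qed.

(** Taylor's formula along the complex line through [z] in direction [v].  The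
    coefficient [16 / e^2] dominates the second order term, and it is large
    enough to keep the whole disc inside the ball where [r] is controlled. *)
Lemma disc_inside G U r p v (e : R) z (a : R[i]) :
  open G -> defining_function G U r -> boundary G p ->
  controlled U r p v e ->
  G z -> norm1 (z - p) <= e ^+ 4 / 4 ->
  16 * e^-1 ^+ 2 * (complex.Re a ^+ 2 + complex.Im a ^+ 2)
    + complex.Re a * dir_deriv r z v + complex.Im a * dir_deriv r z ('i%C *: v)
    < - r z ->
  G (z + a *: v).
Proof.
move=> oG def bp ctrl; have [/andP[e0 e1] v1 cP vP] := ctrl.
set i := e^-1.
have ie : i * e = 1 by rewrite mulVf // gt_eqF.
have i1 : 1 <= i by rewrite invf_ge1.
move=> Gz zp Ha; have [mu0 mu3 _] := defect_bounds oG def bp ctrl Gz zp.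
have zp4 := near_lt_e (introT andP (conj e0 e1)) zp.
have zpe : norm1 (z - p) < e by lra.
have b1 := dir_deriv_le v ctrl zpe.
have b2 := dir_deriv_le ('i%C *: v) ctrl zpe; rewrite norm1Zi in b2.
have dirE : dir_deriv r z (a *: v) = complex.Re a * dir_deriv r z v
    + complex.Im a * dir_deriv r z ('i%C *: v).
  by rewrite complex_scaleE dir_derivD !dir_derivZ.
have av := norm1_scale_le a v.
move: Ha dirE av; rewrite -(real_normK (num_real (complex.Re a))) -(real_normK (num_real (complex.Im a))).
set x := `|complex.Re a|; set y := `|complex.Im a|.
set d1 := dir_deriv r z v in b1 *; set d2 := dir_deriv r z ('i%C *: v) in b2 *.
move=> Ha dirE av.
have x0 : 0 <= x := normr_ge0 _.
have y0 : 0 <= y := normr_ge0 _.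
have d1i : `|d1| <= i by apply: (le_trans b1); rewrite ler_piMr // invr_ge0 ltW.
have d2i : `|d2| <= i by apply: (le_trans b2); rewrite ler_piMr // invr_ge0 ltW.
have t1 : `|complex.Re a * d1| <= x * i by rewrite normrM ler_wpM2l.
have t2 : `|complex.Im a * d2| <= y * i by rewrite normrM ler_wpM2l.
move: t1 t2; rewrite !ler_norml => /andP[t1 _] /andP[t2 _].
have i0 : 0 < i by rewrite invr_gt0.
(* Otherwise the quadratic term would beat both [- r z] and the linear term. *)
have small : x + y < e / 4.
  rewrite ltNge; apply/negP => big.
  have : 8 * i ^+ 2 * (x + y) ^+ 2 <= 16 * i ^+ 2 * (x ^+ 2 + y ^+ 2).
    have : 0 <= (i * (x - y)) ^+ 2 by exact: sqr_ge0.
    nra.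
  have : 2 * i * (x + y) <= 8 * i ^+ 2 * (x + y) ^+ 2.
    have : 1 <= i * (4 * (x + y)).
      by rewrite -[leLHS]ie ler_pM2l //; lra.
    nra.
  have : - r z <= i * (x + y).
    apply: (le_trans mu3); apply: (@le_trans _ _ (x + y)); last by nra.
    apply: le_trans big; rewrite ler_pM2r ?invr_gt0 // exprS ger_pMr //.
    by rewrite exprn_ile1 // ltW.
  lra.
have avs : norm1 (a *: v) <= x + y.
  by apply: (le_trans av); rewrite ler_piMr // addr_ge0.
have zav : norm1 (z - p) + norm1 (a *: v) < e by lra.
have Uza : U (z + a *: v).
  have [] // := cP (z + a *: v); apply: le_lt_trans (norm1_triangle z _ _) _.
  by rewrite [z + _]addrC addrK; lra.
apply: (defining_lt0 def Uza).
have := controlled_taylor ctrl zav; rewrite dirE -/i.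
have : i * norm1 (a *: v) ^+ 2 <= 16 * i ^+ 2 * (x ^+ 2 + y ^+ 2).
  have : norm1 (a *: v) ^+ 2 <= (x + y) ^+ 2.
    by rewrite ler_pXn2r ?nnegrE ?norm1_ge0 ?addr_ge0.
  rewrite -(ler_pM2l i0) => /le_trans -> //.
  have : i * (x + y) ^+ 2 <= i * (2 * (x ^+ 2 + y ^+ 2)).
    by rewrite ler_pM2l //; have := sqr_ge0 (x - y); nra.
  move=> /le_trans -> //.
  have : 0 <= i * (x ^+ 2 + y ^+ 2) by rewrite mulr_ge0 ?(ltW i0) // addr_ge0 ?sqr_ge0.
  nra.
by rewrite ler_norml => T /andP[_ H]; lra.
Qed.

End LocalEstimate.

(** * The local upper bound for the Kobayashi pseudodistance *)

Section Estimate.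
Context {R : realType} {n : nat}.
Implicit Types (x y z w v h p : 'rV[R[i]]_n) (G U : set 'rV[R[i]]_n)
  (r : 'rV[R[i]]_n -> R).
Local Notation normc := ComplexField.Normc.normc.

(** The disc of [disc_inside], after completing the square and division by
    [16 / e^2], is the one of [disc_link_off_center] with the values of [A],
    [c1], [c2] below; and [A] is at least a multiple of the distance [delta] to
    the boundary by [defect_bounds]. *)
Lemma normal_link G U r p v (e : R) z (d s : R) :
  (0 < n)%N -> open G -> bounded_set G -> defining_function G U r ->
  boundary G p -> controlled U r p v e ->
  G z -> norm1 (z - p) <= e ^+ 4 / 4 ->
  0 <= d -> s = 16 * n%:R * e^-1 ^+ 2 * d -> s <= e ^+ 3 / 32 ->
  let delta := eucl_dist z (boundary G) in
  let l := 2^-1 * ln (128 * n%:R * e^-1 ^+ 8 * ((delta + d) / delta)) in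
  disc_link G z (z + s%:C%C *: v) l /\ disc_link G (z + s%:C%C *: v) z l.
Proof.
move=> n0 oG bG def bp ctrl; have [/andP[e0 e1] v1 cP vP] := ctrl.
set i := e^-1.
have ie : i * e = 1 by rewrite mulVf // gt_eqF.
have i1 : 1 <= i by rewrite invf_ge1.
have i0 : 0 < i by lra.
move=> Gz zp d0 s_def s_le delta l.
have N1 : 1 <= n%:R :> R by rewrite ler1n.
have delta0 : 0 < delta by exact: eucl_dist_gt0.
have [mu0 mu3 mud] := defect_bounds oG def bp ctrl Gz zp.
rewrite -/delta in mud.
have zp4 := near_lt_e (introT andP (conj e0 e1)) zp.
have zpe : norm1 (z - p) < e by lra.
have b1 := dir_deriv_le v ctrl zpe.
have b2 := dir_deriv_le ('i%C *: v) ctrl zpe; rewrite norm1Zi in b2.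
have d1e := vP _ zpe.
have inside := fun a => @disc_inside _ _ G U r p v e z a oG def bp ctrl Gz zp.
move: inside b1 b2 d1e; rewrite -/i.
set d1 := dir_deriv r z v; set d2 := dir_deriv r z ('i%C *: v).
move=> inside b1 b2 d1e.
have d1i : `|d1| <= i by apply: (le_trans b1); rewrite ler_piMr // invr_ge0 ltW.
have d2i : `|d2| <= i by apply: (le_trans b2); rewrite ler_piMr // invr_ge0 ltW.
move: mu0 mu3 mud inside; set mu := - r z => mu0 mu3 mud inside.
have s0 : 0 <= s by rewrite s_def !mulr_ge0 ?exprn_ge0 // ltW.
(* The square in [16 / e^2 |a|^2 + Re (a (d1 - i d2)) < mu] is completed. *)
pose A := mu * e ^+ 2 / 16.
pose c1 := - d1 * e ^+ 2 / 32.
pose c2 := - d2 * e ^+ 2 / 32.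
have ee0 : 0 < e ^+ 2 by rewrite exprn_gt0.
have iee : i ^+ 2 * e ^+ 2 = 1 by rewrite -exprMn ie expr1n.
have A0 : 0 < A by rewrite /A divr_gt0 // mulr_gt0.
have sc1 : s <= c1.
  apply: (le_trans s_le); rewrite /c1 exprS ler_pM2r // ler_pM2r //; lra.
have c10 : 0 <= c1 by lra.
apply: (disc_link_off_center (c1 := c1) (c2 := c2) A0 s0 sc1).
  move=> a; set x := complex.Re a; set y := complex.Im a => Ha; apply: inside.
  rewrite -/x -/y -subr_lt0.
  have -> : 16 * i ^+ 2 * (x ^+ 2 + y ^+ 2) + x * d1 + y * d2 - mu =
      16 * i ^+ 2 * (x ^+ 2 + y ^+ 2)
      + (i ^+ 2 * e ^+ 2) * (x * d1 + y * d2 - mu) by rewrite iee; ring.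
  have -> : 16 * i ^+ 2 * (x ^+ 2 + y ^+ 2)
      + (i ^+ 2 * e ^+ 2) * (x * d1 + y * d2 - mu) =
      16 * i ^+ 2 * ((x - c1) ^+ 2 + (y - c2) ^+ 2 - (A + c1 ^+ 2 + c2 ^+ 2)).
    by rewrite /A /c1 /c2; field.
  by rewrite pmulr_rlt0 ?subr_lt0 // mulr_gt0 // exprn_gt0.
set S := A + c1 * s.
have S0 : 0 < S by rewrite /S ltr_pwDl // mulr_ge0.
have c2c1 : `|c2| <= i ^+ 2 * c1.
  have : `|d2| <= i ^+ 2 * - d1.
    apply: (le_trans d2i); rewrite -[leLHS]mulr1 -ie expr2 -mulrA ler_pM2l //.
    by rewrite ler_pM2l //; lra.
  have e32 : 0 < e ^+ 2 / 32 by rewrite divr_gt0.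
  rewrite /c1 /c2 -!(mulrA (- _)) normrM normrN (gtr0_norm e32) => H.
  by rewrite [leRHS]mulrA ler_pM2r.
have c2s : (c2 * s) ^+ 2 <= i ^+ 4 * S ^+ 2.
  have H : `|c2 * s| <= i ^+ 2 * S.
    rewrite normrM (ger0_norm s0); apply: (@le_trans _ _ (i ^+ 2 * (c1 * s))).
      by rewrite mulrA ler_wpM2r.
    by rewrite ler_pM2l ?exprn_gt0 // /S; lra.
  rewrite -[leLHS]real_normK ?num_real //.
  have -> : i ^+ 4 * S ^+ 2 = (i ^+ 2 * S) ^+ 2 by ring.
  by rewrite ler_pXn2r ?nnegrE ?mulr_ge0 ?exprn_ge0 // ltW.
have i4 : 1 <= i ^+ 4 by rewrite exprn_ege1.
apply: (@le_trans _ _ (8 * i ^+ 4 * S ^+ 2)).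
  have : S ^+ 2 <= i ^+ 4 * S ^+ 2 by rewrite ler_peMl ?sqr_ge0.
  by lra.
have -> : 8 * i ^+ 4 * S ^+ 2 = 8 * i ^+ 4 * S * S by ring.
rewrite [leRHS]mulrA ler_pM2r //.
have c1s : c1 * s <= e / 32 * s.
  rewrite ler_wpM2r // /c1 ler_pM2r //.
  rewrite [leRHS](_ : e = i * e ^+ 2); last by rewrite expr2 mulrA ie mul1r.
  rewrite ler_pM2r //; apply: le_trans d1i; rewrite -normrN; exact: ler_norm.
have Ad : e ^+ 3 / 32 <= A / delta.
  rewrite ler_pdivlMr // /A.
  have -> : e ^+ 3 / 32 * delta = (e * delta) * e ^+ 2 / 32 by ring.
  have -> : mu * e ^+ 2 / 16 = (2 * mu) * e ^+ 2 / 32 by field.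
  by rewrite ler_pM2r // ler_pM2r.
have -> : 128 * n%:R * i ^+ 8 * ((delta + d) / delta) * A =
    128 * n%:R * i ^+ 8 * A + 128 * n%:R * i ^+ 8 * d * (A / delta).
  by field; rewrite gt_eqF.
have H1 : 128 * n%:R * i ^+ 8 * d * (e ^+ 3 / 32)
    <= 128 * n%:R * i ^+ 8 * d * (A / delta).
  have i80 : 0 <= i ^+ 8 by rewrite exprn_ge0 // ltW.
  by rewrite ler_wpM2l // mulr_ge0 // mulr_ge0.
have H2 : 8 * i ^+ 4 * (c1 * s) <= 8 * i ^+ 4 * (e / 32 * s).
  by rewrite ler_pM2l // mulr_gt0 // exprn_gt0.
have H3 : 128 * n%:R * i ^+ 8 * d * (e ^+ 3 / 32) = 8 * i ^+ 4 * (e / 32 * s).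
  rewrite s_def -/i.
  have -> : 128 * n%:R * i ^+ 8 * d * (e ^+ 3 / 32) =
    4 * n%:R * d * i ^+ 6 * e * (i ^+ 2 * e ^+ 2) by field.
  by rewrite iee; field.
have H4 : 8 * i ^+ 4 * A <= 128 * n%:R * i ^+ 8 * A.
  rewrite ler_pM2r //.
  have -> : 128 * n%:R * i ^+ 8 = 8 * i ^+ 4 * (16 * n%:R * i ^+ 4) by ring.
  rewrite ler_peMr ?mulr_ge0 ?exprn_ge0 ?ltW //; nra.
have -> : 8 * i ^+ 4 * S = 8 * i ^+ 4 * A + 8 * i ^+ 4 * (c1 * s) by rewrite /S; ring.
lra.
Qed.

Lemma ln_ratio (D delta d : R) : 0 < D -> 0 < delta -> 0 <= d ->
  2^-1 * ln (D * ((delta + d) / delta)) =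
  2^-1 * ln D + 2^-1 * ln (delta + d) - 2^-1 * ln delta.
Proof.
move=> D0 de0 d0; have dd : 0 < delta + d by lra.
rewrite lnM ?posrE ?divr_gt0 // ln_div ?posrE //; ring.
Qed.

Definition kobayashi_bound G (C : R) z w :=
  (kobayashi G z w <=
    (- 2^-1 * (ln (eucl_dist z (boundary G)) + ln (eucl_dist w (boundary G)))
     + 2^-1 * (ln (eucl_dist z (boundary G) + eucl_norm (z - w)) +
               ln (eucl_dist w (boundary G) + eucl_norm (z - w))) + C)%:E)%E.

Definition bound_const (e : R) : R := ln (128 * n%:R * e^-1 ^+ 8) + 2^-1 * ln (16 / 3).

(** Chosen so that points [z], [w] in the same ball satisfy the smallness
    condition [s <= e^3 / 32] of [normal_link] for [s = 16 n |z - w| / e^2]. *)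
Definition bound_radius (e : R) : R := e ^+ 5 / (2048 * n%:R ^+ 2).

(** Three links: [z] to [z + s v], across to [w + s v], and back out to [w].
    The factor [16 n / e^2] in [s] makes the gain [s e / 2] in [- r] equal to the
    bound [8 n |z - w| / e] for the variation of [r] along the middle disc, so
    that there [r] stays at most [r z < 0]. *)
Lemma kobayashi_near_boundary G U r p v (e : R) z w :
  (0 < n)%N -> open G -> bounded_set G -> defining_function G U r ->
  boundary G p -> controlled U r p v e ->
  G z -> norm1 (z - p) <= e ^+ 4 / 4 -> G w -> norm1 (w - p) <= e ^+ 4 / 4 ->
  eucl_norm (z - w) <= 4 * n%:R * bound_radius e ->
  kobayashi_bound G (bound_const e) z w.
Proof.
move=> n0 oG bG def bp ctrl Gz zp Gw wp dr.
have [/andP[e0 e1] v1 cP vP] := ctrl.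
have d0 := eucl_norm_ge0 (z - w); have dN := norm1_le_eucl (z - w).
rewrite /kobayashi_bound; move: d0 dr dN; set d := eucl_norm (z - w) => d0 dr dN.
set i := e^-1.
have ie : i * e = 1 by rewrite mulVf // gt_eqF.
have i1 : 1 <= i by rewrite invf_ge1.
have i0 : 0 < i by lra.
have N1 : 1 <= n%:R :> R by rewrite ler1n.
pose s := 16 * n%:R * i ^+ 2 * d.
have iee : i ^+ 2 * e ^+ 2 = 1 by rewrite -exprMn ie expr1n.
have nd : n%:R * d <= e ^+ 5 / 512.
  have -> : e ^+ 5 / 512 = n%:R * (4 * n%:R * bound_radius e).
    by rewrite /bound_radius; field; rewrite pnatr_eq0 -lt0n.
  by rewrite ler_wpM2l.
have s_le : s <= e ^+ 3 / 32.
  have -> : s = 16 * i ^+ 2 * (n%:R * d) by rewrite /s; ring.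
  have -> : e ^+ 3 / 32 = 16 * i ^+ 2 * (e ^+ 5 / 512).
    have -> : 16 * i ^+ 2 * (e ^+ 5 / 512) = (i ^+ 2 * e ^+ 2) * e ^+ 3 / 32 by field.
    by rewrite iee mul1r.
  by rewrite ler_pM2l // mulr_gt0 // exprn_gt0.
have s0 : 0 <= s by rewrite /s !mulr_ge0 ?exprn_ge0 // ltW.
have [lz _] := normal_link n0 oG bG def bp ctrl Gz zp d0 (erefl s) s_le.
have [_ lw] := normal_link n0 oG bG def bp ctrl Gw wp d0 (erefl s) s_le.
have zp4 := near_lt_e (introT andP (conj e0 e1)) zp.
have e2 : e ^+ 2 <= e by rewrite expr2 ger_pMr.
have e3 : e ^+ 3 <= e ^+ 2 by rewrite [e ^+ 3]exprS ger_pMl ?exprn_gt0.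
have e5 : e ^+ 5 <= e ^+ 2.
  by rewrite (exprD e 3 2) ger_pMl ?exprn_gt0 // exprn_ile1 // ltW.
have sv : norm1 (s%:C%C *: v) <= s.
  by rewrite norm1Z ger0_norm // ler_piMr.
have [mu0 _ _] := defect_bounds oG def bp ctrl Gz zp.
have zpe : norm1 (z - p) < e by lra.
have zs : norm1 (z - p) + norm1 (s%:C%C *: v) < e by lra.
have rz' : r (z + s%:C%C *: v) < - (8 * (n%:R * d) * i).
  have := controlled_taylor ctrl zs.
  have dv : dir_deriv r z (s%:C%C *: v) <= - (s * e).
    by rewrite dir_derivZ -mulrN ler_wpM2l // vP.
  have se : s * e = 16 * (n%:R * d) * i.
    have -> : s * e = 16 * (n%:R * d) * i * (i * e) by rewrite /s; ring.
    by rewrite ie mulr1.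
  have h2 : i * norm1 (s%:C%C *: v) ^+ 2 <= 8 * (n%:R * d) * i.
    have : norm1 (s%:C%C *: v) ^+ 2 <= s ^+ 2 by rewrite ler_pXn2r ?nnegrE ?norm1_ge0.
    rewrite -(ler_pM2l i0) => /le_trans -> //.
    have s2 : s <= e ^+ 2 / 2 by lra.
    have -> : i * s ^+ 2 = i * s * s by ring.
    have -> : 8 * (n%:R * d) * i = i * s * (e ^+ 2 / 2).
      have -> : i * s * (e ^+ 2 / 2) = 8 * (n%:R * d) * i * (i ^+ 2 * e ^+ 2).
        by rewrite /s; field.
      by rewrite iee mulr1.
    by rewrite ler_wpM2l // mulr_ge0 // ltW.
  by rewrite -/i ler_norml => /andP[_ H]; lra.
have lm : disc_link G (z + s%:C%C *: v) (w + s%:C%C *: v) (2^-1 * ln (16 / 3)).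
  have -> : w + s%:C%C *: v = z + s%:C%C *: v + (w - z).
    by rewrite addrAC [z + _]addrC subrK.
  apply: disc_link_near => a a2; set z' := z + _ in rz' *.
  have ah : norm1 (a *: (w - z)) <= 8 * (n%:R * d).
    apply: (le_trans (norm1_scale_le _ _)).
    have := Re_le_normc a; have := Im_le_normc a => Ia Ra.
    rewrite norm1_distC.
    apply: (@le_trans _ _ (4 * norm1 (z - w))); last by lra.
    by rewrite ler_wpM2r ?norm1_ge0 //; lra.
  have z'p : norm1 (z' - p) + norm1 (a *: (w - z)) < e.
    have : norm1 (z' - p) <= norm1 (z' - z) + norm1 (z - p) by exact: norm1_triangle.
    rewrite /z' [z + _]addrC addrK; lra.
  have Uy : U (z' + a *: (w - z)).
    have [] // := cP (z' + a *: (w - z)).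
    apply: le_lt_trans (norm1_triangle z' _ _) _.
    by rewrite [z' + _]addrC addrK; lra.
  apply: (defining_lt0 def Uy).
  have := controlled_lipschitz ctrl z'p; rewrite -/i ler_norml => /andP[_ H].
  have : i * norm1 (a *: (w - z)) <= i * (8 * (n%:R * d)) by rewrite ler_pM2l.
  by lra.
have D0 : 0 < 128 * n%:R * i ^+ 8 by rewrite !mulr_gt0 ?exprn_gt0 //; lra.
have dz := eucl_dist_gt0 n0 oG bG Gz; have dw := eucl_dist_gt0 n0 oG bG Gw.
apply: (le_trans (kobayashi_link3 lz lm lw)).
rewrite !ln_ratio // lee_fin /bound_const -/i.
by rewrite le_eqVlt; apply/orP; left; apply/eqP; field.
Qed.

(** The logarithmic terms of the bound have a nonnegative sum, so that a bounded
    link is enough. *)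
Lemma kobayashi_interior G (e : R) z w :
  (0 < n)%N -> open G -> bounded_set G -> 0 < e <= 1 -> G z -> G w ->
  (forall a : R[i], normc a < 2 -> G (z + a *: (w - z))) ->
  kobayashi_bound G (bound_const e) z w.
Proof.
move=> n0 oG bG /andP[e0 e1] Gz Gw H.
have dz := eucl_dist_gt0 n0 oG bG Gz; have dw := eucl_dist_gt0 n0 oG bG Gw.
have d0 := eucl_norm_ge0 (z - w).
have := kobayashi_link (disc_link_near H); rewrite addrC subrK => /le_trans; apply.
rewrite lee_fin.
have h1 : ln (eucl_dist z (boundary G)) <= ln (eucl_dist z (boundary G) + eucl_norm (z - w)).
  by rewrite ler_ln ?posrE; lra.
have h2 : ln (eucl_dist w (boundary G)) <= ln (eucl_dist w (boundary G) + eucl_norm (z - w)).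
  by rewrite ler_ln ?posrE; lra.
have : 0 <= ln (128 * n%:R * e^-1 ^+ 8).
  apply: ln_ge0; rewrite -[leLHS]mulr1; apply: ler_pM => //.
    have : 1 <= n%:R :> R by rewrite ler1n.
    by lra.
  by rewrite exprn_ege1 // invf_ge1.
rewrite /bound_const; lra.
Qed.

Definition uniformly_controlled G (e : R) := exists U r,
  defining_function G U r /\ forall p, boundary G p -> exists v, controlled U r p v e.

(** Either [zeta] is within [e^4 / 8] of a boundary point, and the bound near
    that point applies, or a ball of this radius around [zeta] lies in [G] and
    contains the affine disc through [z] and [w]. *)
Lemma kobayashi_uniform G (e : R) zeta z w :
  (0 < n)%N -> open G -> bounded_set G -> 0 < e <= 1 ->
  uniformly_controlled G e -> G zeta ->
  G z -> eucl_ball zeta (bound_radius e) z ->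
  G w -> eucl_ball zeta (bound_radius e) w ->
  kobayashi_bound G (bound_const e) z w.
Proof.
move=> n0 oG bG e01 [U [r [def ctrl]]] Gzeta Gz zz Gw ww.
have /andP[e0 e1] := e01.
have N1 : 1 <= n%:R :> R by rewrite ler1n.
have rho2 : 2 * n%:R * bound_radius e <= e ^+ 5 / 1024.
  have -> : 2 * n%:R * bound_radius e = e ^+ 5 / 1024 / n%:R.
    by rewrite /bound_radius; field; rewrite pnatr_eq0 -lt0n.
  have q0 : 0 <= e ^+ 5 / 1024 by have : 0 < e ^+ 5 by [rewrite exprn_gt0]; lra.
  have N0 : 0 < n%:R :> R by rewrite ltr0n.
  by move: (e ^+ 5 / 1024) q0 => q q0; rewrite ler_pdivrMr // ler_peMr.
have e54 : e ^+ 5 <= e ^+ 4 by rewrite [e ^+ 5]exprS ger_pMl // exprn_gt0.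
have e40 : 0 < e ^+ 4 by rewrite exprn_gt0.
have near x : eucl_ball zeta (bound_radius e) x -> norm1 (x - zeta) <= e ^+ 4 / 1024.
  rewrite /eucl_ball /= => xz; apply: (le_trans (norm1_le_eucl _)).
  apply: (@le_trans _ _ (2 * n%:R * bound_radius e)); last lra.
  by rewrite ler_wpM2l ?mulr_ge0 // ltW.
have nz := near _ zz; have nw := near _ ww.
have zw : norm1 (z - w) <= norm1 (z - zeta) + norm1 (w - zeta).
  by rewrite (norm1_distC w) norm1_triangle.
have [[p [bp zetap]]|far] := pselect (exists p, boundary G p /\ norm1 (zeta - p) < e ^+ 4 / 8).
  have [v cv] := ctrl p bp.
  apply: (kobayashi_near_boundary n0 oG bG def bp cv) => //.
  - by apply: (le_trans (norm1_triangle zeta _ _)); lra.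
  - by apply: (le_trans (norm1_triangle zeta _ _)); lra.
  - have nn x : eucl_ball zeta (bound_radius e) x -> norm1 (x - zeta) <= 2 * n%:R * bound_radius e.
      rewrite /eucl_ball /= => xz; apply: (le_trans (norm1_le_eucl _)).
      by rewrite ler_wpM2l ?mulr_ge0 // ltW.
    have := nn _ zz; have := nn _ ww; have := eucl_norm_le_norm1 (z - w); lra.
apply: kobayashi_interior => // a a2.
apply: contrapT => nG; apply: far.
have E : z + a *: (w - z) = zeta + (z + a *: (w - z) - zeta).
  by rewrite [zeta + _]addrC subrK.
rewrite E in nG.
have [t [t0 t1 bt]] := segment_meets_boundary oG Gzeta nG.
eexists; split; first exact: bt.
rewrite opprD addrA subrr sub0r norm1N norm1Z ger0_norm //.
have ah : norm1 (a *: (w - z)) <= 4 * norm1 (z - w).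
  apply: (le_trans (norm1_scale_le _ _)).
  have := Re_le_normc a; have := Im_le_normc a => Ia Ra.
  by rewrite norm1_distC ler_wpM2r ?norm1_ge0 //; lra.
apply: (@le_lt_trans _ _ (norm1 (z + a *: (w - z) - zeta))).
  by rewrite ler_piMl // norm1_ge0.
rewrite addrAC; apply: (le_lt_trans (norm1D _ _)); lra.
Qed.

End Estimate.

(** * Stability of the local control under C^2 perturbation *)

Section C2Estimates.
Context {R : realType} {n : nat}.
Implicit Types (x y z w v h p : 'rV[R[i]]_n) (G U : set 'rV[R[i]]_n)
  (f g r : 'rV[R[i]]_n -> R).

Lemma partialB k f g z : has_partial k f z -> has_partial k g z ->
  partial k (fun y => f y - g y) z = partial k f z - partial k g z.
Proof.
move=> df dg; rewrite /partial !derive1E.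
exact: (@deriveB _ _ _ (along k f z) (along k g z)).
Qed.

Lemma partial_near k f g z : (\forall y \near z, f y = g y) ->
  partial k f z = partial k g z.
Proof.
move=> fg; rewrite /partial !derive1E; apply: near_eq_derive.
have := @continuous_segment _ _ z (coord_vec k) 0.
by rewrite /continuous_at scale0r addr0 => /(_ _ fg).
Qed.

(** The second derivatives need openness of [U]: the first derivatives of
    the difference [f - g] are the differences of first derivatives only at
    points of [U], and these must form a neighbourhood of [y] before one can
    differentiate again. *)
Lemma C2norm_bounds U f g (e : R) y : open U -> C2_on U f -> C2_on U g ->
  (C2norm U (fun z => (f z - g z)%R) < e%:E)%E -> U y ->
  [/\ `|f y - g y| < e, forall k, `|partial k f y - partial k g y| < e &
     forall k l, `|partial l (partial k f) y - partial l (partial k g) y| < e].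
Proof.
move=> oU [_ df _ ddf _] [_ dg _ ddg _] fge Uy.
have sup (x : \bar R) : ([set x | exists2 z, U z & x = `|f z - g z|%:E] `|`
  [set x | exists k, exists2 z, U z & x = `|partial k (fun z => f z - g z) z|%:E] `|`
  [set x | exists k l, exists2 z, U z &
     x = `|partial l (partial k (fun z => f z - g z)) z|%:E]) x -> (x < e%:E)%E.
  by move=> Sx; apply: le_lt_trans fge; exact: ereal_sup_ubound.
have pB k z : U z -> partial k (fun z => f z - g z) z = partial k f z - partial k g z.
  by move=> Uz; apply: partialB; [apply: df|apply: dg]; exact: mem_set.
split=> [|k|k l]; rewrite -lte_fin; apply: sup.
- by left; left; exists y.
- by left; right; exists k, y => //; rewrite pB.
- right; exists k, l, y => //; congr (`|_|%:E).
  rewrite -partialB; last 2 first.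
  + by apply: ddf; exact: mem_set.
  + by apply: ddg; exact: mem_set.
  apply/esym/partial_near; have : nbhs y U by apply: open_nbhs_nbhs.
  by apply: filterS => z /(pB k).
Qed.

Lemma sum_delta (D : 'I_n * bool -> R) k : \sum_l D l * (l == k)%:R = D k.
Proof.
rewrite (bigD1 k) //= eqxx mulr1 big1 ?addr0 // => l /negbTE ->.
by rewrite mulr0.
Qed.

Lemma dir_deriv_coord r z k : dir_deriv r z (coord_vec k) = partial k r z.
Proof.
rewrite -(sum_delta (fun l => partial l r z)).
by apply: eq_bigr => l _; rewrite re_coord_vec.
Qed.

Lemma boundary_of_zero G U r p : defining_function G U r -> U p -> r p = 0 ->
  boundary G p.
Proof.
move=> [[oU bU] _ E1 E2 _] Up rp; split.
  apply: contrapT => nc; have : (~` closure G `&` U) p by [].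
  by rewrite E2 => -[_]; rewrite rp ltxx.
move=> /interior_subset Gp; have : (G `&` U) p by [].
by rewrite E1 => -[_]; rewrite rp ltxx.
Qed.

Lemma partial_neq0_of_dbar r p : dbar r p != 0 -> exists k, partial k r p != 0.
Proof.
move=> dn; apply: contrapT => H; move/eqP: dn; apply.
have H0 k : partial k r p = 0.
  by apply/eqP; apply: contrapT => /negP pk; apply: H; exists k.
by apply/rowP => j; rewrite !mxE !H0 -[Complex 0 0]/(0 : R[i]) mul0r.
Qed.

Lemma pos_min4 (a b c d : R) : 0 < a -> 0 < b -> 0 < c -> 0 < d ->
  exists e, [/\ 0 < e, e <= a, e <= b, e <= c & e <= d].
Proof.
move=> a0 b0 c0 d0; exists (Num.min (Num.min a b) (Num.min c d)).
by split; rewrite ?lt_min ?ge_min ?lexx ?orbT //= a0 b0 c0 d0.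
Qed.

Lemma controlled_mono U r p v (e e' : R) : controlled U r p v e -> 0 < e' <= e ->
  controlled U r p v e'.
Proof.
move=> [/andP[e0 e1] v1 H1 H2] /andP[e'0 e'e]; split=> //.
- by rewrite e'0 (le_trans e'e).
- have ie : e^-1 <= e'^-1 by rewrite lef_pV2.
  move=> y yp; have [Uy h1 h2] := H1 y (lt_le_trans yp e'e); split=> //.
    by move=> k; have [? H] := h1 k; split=> //; exact: le_trans ie.
  by move=> k l; have [? H] := h2 k l; split=> //; exact: le_trans ie.
- by move=> y yp; rewrite (le_trans (H2 y (lt_le_trans yp e'e))) // lerN2.
Qed.

Lemma near_finite_family (I : finType) (F : I -> 'rV[R[i]]_n -> R) p (e : R) :
  0 < e -> (forall j, {for p, continuous (F j)}) ->
  exists2 eta : R, 0 < eta &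
    forall y, norm1 (y - p) < eta -> forall j, `|F j y - F j p| < e.
Proof.
move=> e0 cF; apply/nbhs_norm1P.
have H j : nbhs p [set y | `|F j y - F j p| < e].
  have [eta eta0 H] := continuous_norm1 (cF j) e0.
  by apply/nbhs_norm1P; exists eta.
exact: (@filter_forall _ I (fun j y => `|F j y - F j p| < e) (nbhs p) _ H).
Qed.

Lemma finite_family_bound (I : finType) (F : I -> R) :
  exists2 A : R, 0 <= A & forall j, `|F j| <= A.
Proof.
exists (\sum_j `|F j|) => [|j]; first by rewrite sumr_ge0.
by rewrite (bigD1 j) //= lerDl sumr_ge0.
Qed.

Lemma norm_le_of_close (t0 t1 t2 A d e : R) : `|t0| <= A -> `|t1 - t0| < d ->
  `|t2 - t1| < e -> d <= 1 -> e <= 1 -> `|t2| <= A + 2.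
Proof.
rewrite !ltr_norml !ler_norml => /andP[? ?] /andP[? ?] /andP[? ?] ? ?.
by apply/andP; split; lra.
Qed.

Lemma sign_of_close (t0 t1 t2 d e : R) : t0 != 0 -> `|t1 - t0| < d ->
  `|t2 - t1| < e -> d <= `|t0| / 4 -> e <= `|t0| / 4 -> - Num.sg t0 * t2 <= - e.
Proof.
rewrite !ltr_norml; case: (ltrgt0P t0) => [t00|t00|->] //.
  by rewrite gtr0_sg // => _ /andP[? ?] /andP[? ?] ? ?; lra.
by rewrite ltr0_sg // => _ /andP[? ?] /andP[? ?] ? ?; lra.
Qed.

(** If [r0 p0 != 0] then no [r] close to [r0] vanishes near [p0], and there is
    nothing to prove.  Otherwise some real partial derivative of [r0] is nonzero
    at [p0], and the corresponding coordinate direction, with the right sign, is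
    inward for all [r] close to [r0] at all points near [p0]. *)
Lemma controlled_local U G0 r0 p0 : defining_function G0 U r0 -> U p0 ->
  exists2 e : R, 0 < e <= 1 & forall G r p, open G -> defining_function G U r ->
    (C2norm U (fun z => (r z - r0 z)%R) < e%:E)%E -> norm1 (p - p0) < e ->
    boundary G p -> exists v, controlled U r p v e.
Proof.
move=> def0 Up0; have [[oU _] C0 _ _ nz] := def0.
have [c0 d1 c1 d2 c2] := C0.
have one0 : 0 < 1 :> R by [].
have two0 : 0 < 2 :> R by [].
have four0 : 0 < 4 :> R by [].
have mU y : U y -> y \in U by exact: mem_set.
have [etaU etaU0 HU] := open_norm1 oU Up0.
have [rp0|/eqP rp0] := eqVneq (r0 p0) 0; last first.
  have a0 : 0 < `|r0 p0| / 2 by rewrite divr_gt0 // normr_gt0; apply/eqP.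
  have [eta eta0 Heta] := continuous_norm1 (c0 _ (mU _ Up0)) a0.
  have [e [e0 ea eeta _ e1]] := pos_min4 a0 eta0 eta0 one0.
  exists e; first by rewrite e0.
  move=> G r p oG def rr0 pp0 bp.
  have [Up rp] := defining_boundary oG def bp; have [_ C _ _ _] := def.
  have [+ _ _] := C2norm_bounds oU C C0 rr0 Up.
  rewrite rp sub0r normrN => H.
  have := Heta p (lt_le_trans pp0 eeta).
  have : `|r0 p0| <= `|r0 p| + `|r0 p - r0 p0|.
    by rewrite -{1}(subrK (r0 p) (r0 p0)) addrC (distrC (r0 p)) ler_normD.
  lra.
have [k0 k0n] := partial_neq0_of_dbar (nz _ (boundary_of_zero def0 Up0 rp0)).
set a := `|partial k0 r0 p0|; have a0 : 0 < a by rewrite normr_gt0.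
have [d [dp da d1' _ _]] := pos_min4 (divr_gt0 a0 four0) one0 one0 one0.
have [eta1 eta10 H1] := @near_finite_family _ (fun k => partial k r0) p0 d dp
  (fun k => c1 k _ (mU _ Up0)).
have [eta2 eta20 H2] := @near_finite_family _
  (fun kl : ('I_n * bool) * ('I_n * bool) => partial kl.2 (partial kl.1 r0)) p0 d dp
  (fun kl => c2 kl.1 kl.2 _ (mU _ Up0)).
have [A [A0 A1 A2]] : exists A : R, [/\ 0 <= A,
    forall k, `|partial k r0 p0| <= A &
    forall k l, `|partial l (partial k r0) p0| <= A].
  have [A1 A10 hA1] := finite_family_bound (fun k => partial k r0 p0).
  have [A2 A20 hA2] := finite_family_bound
    (fun kl : ('I_n * bool) * ('I_n * bool) => partial kl.2 (partial kl.1 r0) p0).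
  exists (A1 + A2); split=> [|k|k l]; first exact: addr_ge0.
  - by apply: (le_trans (hA1 k)); rewrite lerDl.
  - by apply: (le_trans (hA2 (k, l))); rewrite lerDr.
have Ap : 0 < (A + 2)^-1 by rewrite invr_gt0; lra.
have [eta [etap etaU' eta1' eta2' _]] := pos_min4 etaU0 eta10 eta20 one0.
have [e [e0 ea eeta eA e1]] :=
  pos_min4 (divr_gt0 a0 four0) (divr_gt0 etap two0) Ap one0.
(* A quarter of the slope at [p0] is lost to the variation of the derivative of
   [r0], and another quarter to the passage from [r0] to [r]. *)
exists e; first by rewrite e0.
move=> G r p oG def rr0 pp0 bp; have [_ C _ _ _] := def.
have [c0' d1r c1' d2r c2'] := C.
have yp0 y : norm1 (y - p) < e -> norm1 (y - p0) < eta.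
  move=> yp; apply: (le_lt_trans (norm1_triangle p _ _)); lra.
have Uy y : norm1 (y - p) < e -> U y.
  by move=> /yp0 yp; apply: HU; exact: lt_le_trans etaU'.
have ieA : A + 2 <= e^-1 by rewrite -[leLHS]invrK lef_pV2 // posrE.
pose s := - Num.sg (partial k0 r0 p0).
exists (s%:C%C *: coord_vec k0); split.
- by rewrite e0.
- by rewrite norm1Z norm1_coord_vec mulr1 normrN normr_sg k0n.
- move=> y yp; have Uy' := Uy _ yp; split=> // [k|k l].
    split; first exact: d1r _ (mU _ Uy').
    have [_ + _] := C2norm_bounds oU C C0 rr0 Uy' => /(_ k) B1.
    have := H1 y (lt_le_trans (yp0 _ yp) eta1') k; have := A1 k => B2 B3.
    exact: (le_trans (norm_le_of_close B2 B3 B1 d1' e1) ieA).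
  split; first exact: d2r _ (mU _ Uy').
  have [_ _ +] := C2norm_bounds oU C C0 rr0 Uy' => /(_ k l) B1.
  have := H2 y (lt_le_trans (yp0 _ yp) eta2') (k, l); have := A2 k l => B2 /= B3.
  exact: (le_trans (norm_le_of_close B2 B3 B1 d1' e1) ieA).
- move=> y yp; rewrite dir_derivZ dir_deriv_coord.
  have [_ + _] := C2norm_bounds oU C C0 rr0 (Uy _ yp) => /(_ k0) B1.
  have := H1 y (lt_le_trans (yp0 _ yp) eta1') k0 => B3.
  exact: (sign_of_close k0n B3 B1 da ea).
Qed.

End C2Estimates.

(** * Compactness and the uniform bound *)

Section Uniformity.
Context {R : realType} {n : nat}.
Implicit Types (p : 'rV[R[i]]_n) (G K U : set 'rV[R[i]]_n)
  (r : 'rV[R[i]]_n -> R).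

(** The local statements are glued over the compact [K] by taking [e] as part of
    the parameter: a covering argument for the filter [0^'+] times [F] yields
    an [e] that works at all points of [K]. *)
Lemma controlled_near (T : Type) (F : set_system T) (FF : Filter F) U K G0 r0
    (G : T -> set 'rV[R[i]]_n) (r : T -> 'rV[R[i]]_n -> R) :
  compact K -> K `<=` U -> defining_function G0 U r0 ->
  (forall e : R, 0 < e ->
     \forall t \near F, (C2norm U (fun z => (r t z - r0 z)%R) < e%:E)%E) ->
  (\forall t \near F, [/\ open (G t), defining_function (G t) U (r t) &
     boundary (G t) `<=` K]) ->
  exists2 e : R, 0 < e <= 1 & \forall t \near F,
    forall p, boundary (G t) p -> exists v, controlled U (r t) p v e.
Proof.
move=> /compact_near_coveringP cK KU def0 close good.
have := cK (R * T)%type (filter_prod 0^'+ F) (fun u p =>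
  boundary (G u.2) p -> exists v, controlled U (r u.2) p v u.1).
move=> /(_ _)[].
  move=> p0 Kp0; have [e0 /andP[e0_gt0 e01] H] := controlled_local def0 (KU _ Kp0).
  exists ([set p | norm1 (p - p0) < e0], [set u : R * T | [/\ 0 < u.1 <= e0,
      open (G u.2), defining_function (G u.2) U (r u.2) &
      (C2norm U (fun z => (r u.2 z - r0 z)%R) < e0%:E)%E]]).
    split=> /=; first by apply/nbhs_norm1P; exists e0.
    exists ([set d : R | 0 < d <= e0], [set t | [/\ open (G t),
      defining_function (G t) U (r t) &
      (C2norm U (fun z => (r t z - r0 z)%R) < e0%:E)%E]]).
      split=> /=.
        by apply: filterS2 (nbhs_right_gt 0) (nbhs_right_le e0_gt0) => d /= -> ->.
      by apply: filterS2 good (close _ e0_gt0) => t [].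
    by move=> [d t] [/= ? []].
  move=> [p [d t]] [/= pp0 [de oG def rr0]] bp.
  by have [v cv] := H _ _ _ oG def rr0 pp0 bp; exists v; exact: controlled_mono cv _.
move=> [A B] [/= A0 FB] sub.
have [e [Ae /andP[e0 e1]]] : exists e : R, A e /\ 0 < e <= 1.
  have : (0 : R)^'+ (A `&` [set e : R | 0 < e <= 1]).
    apply: filterI => //.
    by apply: filterS2 (nbhs_right_gt 0) (nbhs_right_le (@ltr01 R)) => d /= -> ->.
  by move/filter_ex.
exists e; first by rewrite e0.
apply: filterS2 FB good => t Bt [_ _ bK] p bp.
exact: (sub (e, t) _ p (bK _ bp) bp).
Qed.

Lemma uniformly_controlled_mono G (e e' : R) :
  uniformly_controlled G e -> 0 < e' <= e -> uniformly_controlled G e'.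
Proof.
move=> [U [r [def H]]] ee; exists U, r; split=> // p /H[v cv].
by exists v; exact: controlled_mono cv ee.
Qed.

Lemma C2norm_diff0 U r : C2_on U r -> open U ->
  (C2norm U (fun z => (r z - r z)%R) <= 0)%E.
Proof.
move=> [_ d1 _ d2 _] oU; have p0 k z : U z -> partial k (fun z => r z - r z) z = 0.
  by move=> /mem_set Uz; rewrite partialB ?subrr //; exact: d1.
apply: ge_ereal_sup => x [[[z Uz ->]|[k [z Uz ->]]]|[k [l [z Uz ->]]]].
- by rewrite subrr normr0.
- by rewrite p0 // normr0.
- have -> : partial l (partial k (fun z => r z - r z)) z =
      partial l (fun y => partial k r y - partial k r y) z.
    apply: partial_near; have : nbhs z U by apply: open_nbhs_nbhs.
    by apply: filterS => y Uy; rewrite p0 // subrr.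
  by rewrite partialB ?subrr ?normr0 //; apply: d2; exact: mem_set.
Qed.

(** The constant family over a one-point parameter space. *)
Lemma uniformly_controlled_single G : open G -> bounded_set G -> C2_boundary G ->
  exists2 e : R, 0 < e <= 1 & uniformly_controlled G e.
Proof.
move=> oG bG [U [r def]]; have [[oU bU] C _ _ _] := def.
have cb : compact (boundary G).
  by apply: (subclosed_compact (boundary_closed oG) (compact_closed_bounded bG)) => p [].
have [||e e01 H] := @controlled_near unit (globally setT) _ U
  (boundary G) G r (fun=> G) (fun=> r) cb bU def.
- move=> e e0 _ _ /=; apply: le_lt_trans (C2norm_diff0 C oU) _.
  by rewrite lte_fin.
- by move=> _ _ /=; split.
by exists e => //; exists U, r; split=> //; exact: (H tt).
Qed.

Lemma uniformly_controlled_initial (G : nat -> set 'rV[R[i]]_n) (J : nat) :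
  (forall j, exists2 e : R, 0 < e <= 1 & uniformly_controlled (G j) e) ->
  exists2 e : R, 0 < e <= 1 & forall j, (j < J)%N -> uniformly_controlled (G j) e.
Proof.
move=> H; elim: J => [|J [e e01 IH]]; first by exists 1; rewrite ?ltr01 ?lexx.
have [e' e'01 HJ] := H J.
have /andP[e0 e1] := e01; have /andP[e'0 e'1] := e'01.
exists (Num.min e e'); first by rewrite lt_min ge_min e0 e'0 e1.
move=> j; rewrite ltnS leq_eqVlt => /orP[/eqP ->|/IH Hj].
  by apply: uniformly_controlled_mono HJ _; rewrite lt_min e0 e'0 ge_min lexx orbT.
by apply: uniformly_controlled_mono Hj _; rewrite lt_min e0 e'0 ge_min lexx.
Qed.

Lemma kobayashi_bound_family (T : Type) (G : T -> set 'rV[R[i]]_n) (e : R) :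
  (0 < n)%N -> 0 < e <= 1 ->
  (forall t, [/\ domain (G t), bounded_set (G t) & uniformly_controlled (G t) e]) ->
  exists C rho : R, [/\ 0 < C, 0 < rho &
    forall t zeta, G t zeta -> exists V : set 'rV[R[i]]_n,
      [/\ nbhs zeta V, eucl_ball zeta rho `<=` V &
      forall z w, (G t `&` V) z -> (G t `&` V) w -> kobayashi_bound (G t) C z w]].
Proof.
move=> n0 e01 H; have /andP[e0 e1] := e01.
have rho0 : 0 < bound_radius (n := n) e.
  have n2 : 0 < n%:R ^+ 2 :> R by rewrite exprn_gt0 ?ltr0n.
  by apply: divr_gt0; [rewrite exprn_gt0|lra].
have C0 : 0 < bound_const (n := n) e.
  have N1 : 1 <= n%:R :> R by rewrite ler1n.
  have i8 : 1 <= e^-1 ^+ 8 by rewrite exprn_ege1 // invf_ge1.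
  have l1 : 0 < ln (128 * n%:R * e^-1 ^+ 8) by apply: ln_gt0; nra.
  have l2 : 0 <= ln (16 / 3 : R) by apply: ln_ge0; lra.
  by rewrite /bound_const; lra.
exists (bound_const (n := n) e), (bound_radius (n := n) e); split=> //.
move=> t zeta Gzeta; have [[oG _ _] bG uc] := H t.
exists (eucl_ball zeta (bound_radius (n := n) e)); split=> //.
  exact: nbhs_eucl_ball.
by move=> z w [Gz zz] [Gw ww]; apply: (kobayashi_uniform n0 oG bG e01 uc Gzeta).
Qed.

End Uniformity.
Theorem proposition3p7 (R : realType) (n : nat) (n_gt0 : (0 < n)%N) :
  (forall (T : metricType R) (G : T -> set 'rV[R[i]]_n)
          (U : set 'rV[R[i]]_n) (r : T -> 'rV[R[i]]_n -> R),
     compact [set: T] ->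
     (forall t, [/\ domain (G t), bounded_set (G t) & C2_boundary (G t)]) ->
     domain U -> relatively_compact U setT ->
     relatively_compact (\bigcup_t boundary (G t)) U ->
     (forall t, defining_function (G t) U (r t)) ->
     (forall eps : R, 0 < eps -> exists2 delta : R, 0 < delta &
        forall s t : T, mdist s t <= delta ->
          (C2norm U (fun z => (r t z - r s z)%R) < eps%:E)%E) ->
     exists C rho : R, [/\ 0 < C, 0 < rho &
       forall t zeta, G t zeta ->
       exists V : set 'rV[R[i]]_n,
         [/\ nbhs zeta V, eucl_ball zeta rho `<=` V &
         forall z w, (G t `&` V) z -> (G t `&` V) w ->
           (kobayashi (G t) z w <=
             (- 2^-1 * (ln (eucl_dist z (boundary (G t))) +
                        ln (eucl_dist w (boundary (G t))))
              + 2^-1 * (ln (eucl_dist z (boundary (G t)) + eucl_norm (z - w)) +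
                        ln (eucl_dist w (boundary (G t)) + eucl_norm (z - w)))
              + C)%:E)%E]])
  /\
  (forall (G : nat -> set 'rV[R[i]]_n) (Glim : set 'rV[R[i]]_n),
     (forall j, [/\ domain (G j), bounded_set (G j) & C2_boundary (G j)]) ->
     [/\ domain Glim, bounded_set Glim & C2_boundary Glim] ->
     C2_converges G Glim ->
     exists C rho : R, [/\ 0 < C, 0 < rho &
       forall j zeta, G j zeta ->
       exists V : set 'rV[R[i]]_n,
         [/\ nbhs zeta V, eucl_ball zeta rho `<=` V &
         forall z w, (G j `&` V) z -> (G j `&` V) w ->
           (kobayashi (G j) z w <=
             (- 2^-1 * (ln (eucl_dist z (boundary (G j))) +
                        ln (eucl_dist w (boundary (G j))))
              + 2^-1 * (ln (eucl_dist z (boundary (G j)) + eucl_norm (z - w)) +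
                        ln (eucl_dist w (boundary (G j)) + eucl_norm (z - w)))
              + C)%:E)%E]]).
Proof.
split=> [T G U r cT HG _ _ [cK KU] def close|G Glim HG _ [U [j0 [r_ [r [[oU _] [cK KU] def def_ cvg]]]]]].
- have KG t : boundary (G t) `<=` closure (\bigcup_t boundary (G t)).
    by move=> p bp; apply: subset_closure; exists t.
  (* Compactness of the parameter space turns the local values of [e] into one. *)
  have : \forall e \near (0 : R)^'+, setT `<=` (fun t => uniformly_controlled (G t) e).
    move/compact_near_coveringP: cT; apply=> t0 _.
    have [||e /andP[e0 e1] He] := @controlled_near _ _ _ (nbhs t0) _ U _ (G t0) (r t0)
      G r cK KU (def t0).
    + move=> e /close[delta delta0 H]; apply/metricType_numDomainType.nbhs_mdistP.
      by exists delta => // t /ltW /H.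
    + by apply: nearW => t; have [[oG _ _] _ _] := HG t; split.
    exists ([set t | forall p, boundary (G t) p -> exists v, controlled U (r t) p v e],
            [set d : R | 0 < d <= e]).
      split=> //=.
      by apply: filterS2 (nbhs_right_gt 0) (nbhs_right_le e0) => d /= -> ->.
    move=> [t d] [/= Ht de]; exists U, (r t); split=> // p /Ht[v cv].
    by exists v; exact: controlled_mono cv de.
  move=> H; have [e [uc e01]] : exists e : R, setT `<=` (fun t => uniformly_controlled (G t) e)
      /\ 0 < e <= 1.
    have : (0 : R)^'+ ([set e | setT `<=` (fun t => uniformly_controlled (G t) e)]
        `&` [set e : R | 0 < e <= 1]).
      apply: filterI => //.
      by apply: filterS2 (nbhs_right_gt 0) (nbhs_right_le (@ltr01 R)) => d /= -> ->.
    by move/filter_ex.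
  apply: (kobayashi_bound_family n_gt0 e01) => t; have [dG bG _] := HG t.
  by split=> //; exact: uc.
have [||e1 /andP[e10 e11] [J _ HJ]] := @controlled_near _ _ _ \oo _ U _ Glim r
  G r_ cK KU def.
- move=> e e0.
  move: cvg => /(_ [set x | (x < e%:E)%E]); apply.
  by apply: open_nbhs_nbhs; split; [exact: open_ereal_lt_ereal|rewrite /= lte_fin].
- exists j0 => // j /= j0j; have [[oG _ _] _ _] := HG j; split=> //; first exact: def_.
  by move=> p bp; apply: subset_closure; right; exists j.
(* The finitely many domains before the C^2 approximation sets in. *)
have [e2 /andP[e20 e21] H2] := @uniformly_controlled_initial _ _ G (maxn J j0) (fun j =>
  let: And3 dG bG cG := HG j in
  let: And3 oG _ _ := dG in uniformly_controlled_single oG bG cG).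
have e01 : 0 < Num.min e1 e2 <= 1 by rewrite lt_min ge_min e10 e20 e11.
apply: (kobayashi_bound_family n_gt0 e01) => j; have [dG bG _] := HG j; split=> //.
have [jJ|] := ltnP j (maxn J j0).
  by apply: uniformly_controlled_mono (H2 _ jJ) _; rewrite lt_min e10 e20 ge_min lexx orbT.
rewrite geq_max => /andP[Jj j0j].
have uc : uniformly_controlled (G j) e1 by exists U, (r_ j); split; [exact: def_|exact: HJ].
by apply: uniformly_controlled_mono uc _; rewrite lt_min e10 e20 ge_min lexx.
Qed.
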